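(* Let $k\ge0$ and $\mathbf n=(n_1,\dots,n_r)$ with $r\ge1$ and $n_i\ge1$ for all $i$. Let $S:=\{i\in[r]: n_i=1\}$ and let $[r]=A\uplus B$ be a partition with $B\supseteq S$. Put $n_B:=\sum_{i\in B}n_i$, \[ K_1:=\sum_{i\in A}\Big\lfloor\frac{n_i-2}{2}\Big\rfloor+\max\Big\{0,\Big\lfloor\frac{n_B-1}{2}\Big\rfloor\Big\},\qquad K_2:=\big|\{i\in A: n_i\text{ odd}\}\big|+\begin{cases}1&\text{if } n_B \text{ is even and nonzero},\\0&\text{otherwise}.\end{cases} \] Then: (1) if $0\le k\le K_1$, then $\delta_{pr}(k,\mathbf n)\ge r+1-|B|+2k$; (2) if $K_1\le k\le K_1+K_2$, then $\delta_{pr}(k,\mathbf n)\ge r+1-|B|+K_1+k$; (3) if $K_1+K_2\le k$, then $\delta_{pr}(k,\mathbf n)\ge r+1-|B|+2K_1+K_2$.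
   Context: $\Delta_m$ denotes the $m$-dimensional simplex; for $\mathbf n=(n_1,\dots,n_r)$, $\Delta_{\mathbf n}:=\Delta_{n_1}\times\dots\times\Delta_{n_r}$. The $k$-skeleton of a polytope is the poset of its faces of dimension at most $k$; two $k$-skeleta are combinatorially equivalent if these posets are isomorphic. A convex polytope is $(k,\mathbf n)$-PSN if its $k$-skeleton is combinatorially equivalent to that of $\Delta_{\mathbf n}$, and $(k,\mathbf n)$-PPSN if in addition it is the image under a linear projection of a polytope combinatorially equivalent to $\Delta_{\mathbf n}$. $\delta_{pr}(k,\mathbf n)$ is the smallest dimension of a $(k,\mathbf n)$-PPSN polytope. *)

(* Defs.v *)
From HB Require Import structures.
From mathcomp Require Import all_boot all_order all_algebra.
Unset Strict Implicit. Unset Printing Implicit Defensive.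
Import Order.TTheory GRing.Theory Num.Theory.
Local Open Scope ring_scope.

(* A (convex) polytope is given as conv V for a finite point list V in R^d. *)
Definition in_conv (R : rcfType) (d : nat) (V : seq 'rV[R]_d) (x : 'rV[R]_d) : Prop :=
  exists w : 'I_(size V) -> R,
    [/\ forall i, 0 <= w i, \sum_i w i = 1 & x = \sum_i w i *: V`_i].

Arguments in_conv {R d} V x.

Definition dotv (R : rcfType) (d : nat) (x c : 'rV[R]_d) : R :=
  \sum_(j < d) x 0 j * c 0 j.

Arguments dotv {R d} x c.

(* The faces of conv V (including the empty face and conv V itself) are the
   sets {x in conv V | <c,x> = b} for a valid inequality <c,x> <= b.  A face F
   is recorded by the set of indices i with V_i in F (F = conv of these points). *)
Definition is_face (R : rcfType) (d : nat) (V : seq 'rV[R]_d)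
    (I : {set 'I_(size V)}) : Prop :=
  exists (c : 'rV[R]_d) (b : R),
    (forall i : 'I_(size V), dotv V`_i c <= b) /\
    (forall i : 'I_(size V), (i \in I) = (dotv V`_i c == b)).

Arguments is_face {R d} V I.

Definition fdim (R : rcfType) (d : nat) (V : seq 'rV[R]_d)
    (I : {set 'I_(size V)}) : int :=
  match [pick i in I] with
  | Some i0 =>
      (\rank (\matrix_(i < size V) (if i \in I then V`_i - V`_i0 else 0)))%:Z
  | None => -1
  end.

Arguments fdim {R d} V I.

Definition pdim (R : rcfType) (d : nat) (V : seq 'rV[R]_d) : int :=
  fdim V setT.

Arguments pdim {R d} V.

Definition faces_iso (ok : int -> bool) (R : rcfType) (d e : nat)
    (V : seq 'rV[R]_d) (W : seq 'rV[R]_e) : Prop :=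
  exists f : {set 'I_(size V)} -> {set 'I_(size W)},
    [/\ forall I, is_face V I -> ok (fdim V I) ->
          is_face W (f I) /\ ok (fdim W (f I)),
        forall J, is_face W J -> ok (fdim W J) ->
          exists I, [/\ is_face V I, ok (fdim V I) & f I = J] &
        forall I I', is_face V I -> ok (fdim V I) ->
          is_face V I' -> ok (fdim V I') ->
          (I \subset I') = (f I \subset f I')].

Arguments faces_iso ok {R d e} V W.

Definition skel_equiv (k : nat) (R : rcfType) (d e : nat)
    (V : seq 'rV[R]_d) (W : seq 'rV[R]_e) : Prop :=
  faces_iso (fun m => m <= k%:Z) V W.

Arguments skel_equiv k {R d e} V W.

Definition comb_equiv (R : rcfType) (d e : nat)
    (V : seq 'rV[R]_d) (W : seq 'rV[R]_e) : Prop :=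
  faces_iso (fun _ => true) V W.

Arguments comb_equiv {R d e} V W.

(* Standard realization of Delta_n = Delta_{n_1} x ... x Delta_{n_r}:
   Delta_m is conv of the standard basis of R^{m+1}; the product lives in
   R^{sum (n_i+1)}, block i occupying coordinates offset_i .. offset_i + n_i. *)
Definition ps_dim (n : seq nat) : nat := sumn [seq m.+1 | m <- n].
Definition ps_offset (n : seq nat) (i : nat) : nat :=
  sumn (take i [seq m.+1 | m <- n]).
Fixpoint ps_choices (n : seq nat) : seq (seq nat) :=
  match n with
  | [::] => [:: [::]]
  | m :: n' => [seq x :: s | x <- iota 0 m.+1, s <- ps_choices n']
  end.
Definition ps_point (R : rcfType) (n : seq nat) (c : seq nat) : 'rV[R]_(ps_dim n) :=
  \row_(j < ps_dim n)
     (if has (fun i => nat_of_ord j == (ps_offset n i + nth 0%N c i)%N) (iota 0 (size n))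
      then 1 else 0).
Definition prod_simplex (R : rcfType) (n : seq nat) : seq 'rV[R]_(ps_dim n) :=
  [seq ps_point R n c | c <- ps_choices n].

Definition PPSN (R : rcfType) (k : nat) (n : seq nat) (d : nat)
    (V : seq 'rV[R]_d) : Prop :=
  skel_equiv k V (prod_simplex R n) /\
  exists (e : nat) (W : seq 'rV[R]_e) (pi : 'M[R]_(e, d)),
    comb_equiv W (prod_simplex R n) /\
    (forall x, in_conv V x <-> in_conv [seq w *m pi | w <- W] x).
Arguments PPSN {R} k n {d} V.

(* Main.v *)
Require Import Defs.
From HB Require Import structures.
From mathcomp Require Import all_boot all_order all_algebra.
From mathcomp Require Import boolp zify ring.
Import Order.TTheory GRing.Theory Num.Theory.
Local Open Scope ring_scope.
Set Implicit Arguments.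
Unset Strict Implicit.
Unset Printing Implicit Defensive.

(* Let [W] be the polytope equivalent to Delta_n and [pi] the projection, whose
   image [V] has the [k]-skeleton of Delta_n.  Comparing vertices, then edges, then
   vertex degrees shows that [pi] strictly preserves every face of dimension at
   most [k].  Evaluating the facet slacks of [W] on the affine dependencies of the
   projected points gives a space L (a Gale dual) in R^m, with m the number of
   facets; preservation of a face means that a strictly positive combination of
   the coordinates of the facets containing it vanishes on L.  Hence no nonzero
   vector of L has a positive part in the complex of faces of dimension at most
   [k], and every nonzero vector of L + R(1,...,1) has a positive or negative part
   outside it.  Colouring the non-faces so that disjoint ones get different colours,
   as Sarkaria does, bounds dim L + 1 by the number of colours.  That bound only
   needs Tucker's lemma for sign vectors, because a flag of hyperplanes of codimension
   q can itself be turned into q further colours. *)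

(** * Tucker's lemma for sign vectors *)

(** The colour count rests on thresholds. A budget of at most [k] is distributed as [kk i] for the
    blocks outside [B] and [kB] for [B] as a whole; a set beyond the budget passes one of these
    thresholds. Two disjoint sets cannot both pass the same one when few elements are left, so the
    surplus elements are deleted at the price of one colour each. A unit of budget thus saves two
    colours, hence two dimensions, until the deletions run out; parity then leaves a last unit worth
    only one.

    Adjoining the all-ones vector costs no colour and improves the bound by one. If [y + a * 1] with
    [y] in L and [a >= 0] has a small positive part, so has [y], which is then 0; and a positive
    constant vector has full positive part, which is not small because the budget stays below
    [n_1 + ... + n_r]. *)

Lemma symmetric_sum0 (V : zmodType) (I : finType) (F : I -> I -> V) :
    (forall x : V, x + x = 0) -> (forall i, F i i = 0) ->
    (forall i j, F i j = F j i) ->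
  \sum_i \sum_j F i j = 0.
Proof.
move=> ch2 F0 Fs.
pose lt (i j : I) := (enum_rank i < enum_rank j)%N.
have E i j : F i j = (if lt i j then F i j else 0) + (if lt j i then F j i else 0).
  rewrite /lt; case: ltngtP => [ij|ji|/val_inj/enum_rank_inj->].
  - by rewrite addr0.
  - by rewrite add0r Fs.
  - by rewrite F0 addr0.
under eq_bigr => i _ do under eq_bigr => j _ do rewrite E.
under eq_bigr => i _ do rewrite big_split.
by rewrite big_split /= [X in _ + X]exchange_big ch2.
Qed.

Section ModTwoChains.
Variables (L : finType) (neg : L -> L).
Hypotheses (negK : involutive neg).

(** Mod 2 chains of the full simplex on [L], with [bool] as a group under exclusive or. They are
    augmented: the empty set counts as a simplex, and [pt] is its chain. *)
Definition chain := {ffun {set L} -> bool}.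

Lemma chain_addrr (c : chain) : c + c = 0.
Proof. by apply/ffunP => s; rewrite !ffunE; case: (c s). Qed.

Definition bd (c : chain) : chain :=
  [ffun t : {set L} => \sum_(l | l \notin t) c (l |: t)].
Definition cone (v : L) (c : chain) : chain :=
  [ffun s : {set L} => if v \in s then c (s :\ v) else 0].
Definition nu (c : chain) : chain := [ffun s : {set L} => c (neg @: s)].
Definition pt : chain := [ffun s : {set L} => s == set0].

Lemma bdD c d : bd (c + d) = bd c + bd d.
Proof.
by apply/ffunP => t; rewrite !ffunE -big_split; apply: eq_bigr => l _; rewrite ffunE.
Qed.

Lemma bd0 : bd 0 = 0.
Proof. by apply/ffunP => t; rewrite !ffunE big1 // => l _; rewrite ffunE. Qed.

Lemma bd_sum (I : Type) (r : seq I) (P : pred I) (F : I -> chain) :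
  bd (\sum_(i <- r | P i) F i) = \sum_(i <- r | P i) bd (F i).
Proof. exact: (big_morph bd bdD bd0). Qed.

Lemma cone0 v : cone v 0 = 0.
Proof. by apply/ffunP => t; rewrite !ffunE; case: ifP. Qed.

Lemma nuD c d : nu (c + d) = nu c + nu d.
Proof. by apply/ffunP => t; rewrite !ffunE. Qed.

Lemma nu0 : nu 0 = 0.
Proof. by apply/ffunP => t; rewrite !ffunE. Qed.

Lemma nu_sum (I : Type) (r : seq I) (P : pred I) (F : I -> chain) :
  nu (\sum_(i <- r | P i) F i) = \sum_(i <- r | P i) nu (F i).
Proof. exact: (big_morph nu nuD nu0). Qed.

Lemma imneg_inv (s : {set L}) : neg @: (neg @: s) = s.
Proof.
rewrite -imset_comp -[RHS]imset_id; apply: eq_imset => l /=; exact: negK.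
Qed.

Lemma mem_imneg (s : {set L}) l : (l \in neg @: s) = (neg l \in s).
Proof.
apply/imsetP/idP => [[x xs ->]|h]; first by rewrite negK.
by exists (neg l); rewrite ?negK.
Qed.

Lemma nu_bd c : nu (bd c) = bd (nu c).
Proof.
apply/ffunP => t; rewrite !ffunE (reindex_inj (inv_inj negK)).
apply: eq_big => [l|l _]; first by rewrite mem_imneg negK.
by rewrite ffunE imsetU1.
Qed.

Lemma nu_cone v c : nu (cone v c) = cone (neg v) (nu c).
Proof.
apply/ffunP => t; rewrite !ffunE mem_imneg; case: ifP => // _.
congr (c _); apply/setP => l; rewrite !inE !mem_imneg !inE.
by rewrite (inv_eq negK) negK.
Qed.

Lemma nu_pt : nu pt = pt.
Proof.
apply/ffunP => s; rewrite !ffunE; apply/eqP/eqP => [h|->]; last by rewrite imset0.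
by rewrite -[s]imneg_inv h imset0.
Qed.

Lemma bd_pt : bd pt = 0.
Proof.
apply/ffunP => t; rewrite !ffunE big1 // => l _; rewrite ffunE.
by apply/negbTE/set0Pn; exists l; rewrite setU11.
Qed.

Lemma bd_bd c : bd (bd c) = 0.
Proof.
apply/ffunP => t; rewrite [RHS]ffunE.
pose F (l l' : L) : bool :=
  if [&& l \notin t, l' \notin t & l != l'] then c (l' |: (l |: t)) else 0.
transitivity (\sum_l \sum_l' F l l'); last first.
  apply: symmetric_sum0 => [[]|l|l l'] //; rewrite /F.
    by rewrite eqxx !andbF.
  by rewrite setUCA [l' == l]eq_sym; do 2!case: (_ \notin t) => //=.
rewrite ffunE [RHS](bigID (fun l => l \notin t)) /= [X in _ + X]big1 ?addr0 => [|l].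
  apply: eq_bigr => l lt; rewrite ffunE [RHS](bigID (fun l' => l' \notin l |: t)) /=.
  rewrite [X in _ + X]big1 ?addr0 => [|l']; rewrite /F.
    by apply: eq_bigr => l'; rewrite !inE negb_or lt eq_sym => /andP[-> ->].
  by rewrite negbK !inE lt eq_sym /= => /orP[->|->]; rewrite ?andbF.
by rewrite /F => /negbTE ->; rewrite big1.
Qed.

(** A simplex of [c] containing [v] has cone 0, and the right side cancels too: among its facets
    only the one opposite [v] has a nonzero cone, namely the simplex itself. *)
Lemma bd_cone v c : bd (cone v c) = c + cone v (bd c).
Proof.
apply/ffunP => t; rewrite !ffunE; case: ifPn => vt.
  rewrite [in RHS](bigD1 v) ?inE ?eqxx //= setD1K // addrA.
  rewrite (_ : c t + c t = 0) ?add0r; last by case: (c t).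
  apply: eq_big => [l|l lt].
    by rewrite !inE; case: eqVneq => [->|] /=; rewrite ?vt ?andbT.
  rewrite ffunE inE vt orbT; congr (c _); apply/setP => x; rewrite !inE.
  by case: (eqVneq x v) => //= ->; case: eqVneq => // vl; rewrite -vl vt in lt.
rewrite addr0 (bigD1 v) //= ffunE setU11 big1 ?addr0 => [|l /andP[lt lv]].
  congr (c _); apply/setP => x; rewrite !inE.
  by case: eqVneq => //= ->; rewrite (negbTE vt).
by rewrite ffunE !inE eq_sym (negbTE lv) (negbTE vt).
Qed.

End ModTwoChains.

Section SignVectors.
Variable m : nat.

Definition signvec := {ffun 'I_m -> option bool}.
Definition sv_supp (X : signvec) : {set 'I_m} := [set i | X i != None].
Definition sv_le (X Y : signvec) := [forall i, (X i == None) || (X i == Y i)].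
Definition sv_opp (X : signvec) : signvec := [ffun i => omap negb (X i)].
Definition sv_set (X : signvec) (j : 'I_m) (a : option bool) : signvec :=
  [ffun i => if i == j then a else X i].

Lemma sv_suppP (X : signvec) i : reflect (X i = None) (i \notin sv_supp X).
Proof. by rewrite inE negbK; apply: eqP. Qed.

Lemma sv_leP (X Y : signvec) : reflect (forall i, i \in sv_supp X -> X i = Y i) (sv_le X Y).
Proof.
apply: (iffP forallP) => [h i | h i]; first by rewrite inE; case/orP: (h i) => /eqP->.
by case: eqVneq => //= Xi; rewrite h ?inE ?eqxx.
Qed.

Lemma sv_le_refl X : sv_le X X.
Proof. by apply/forallP => i; rewrite eqxx orbT. Qed.

Lemma sv_le_trans Y X Z : sv_le X Y -> sv_le Y Z -> sv_le X Z.
Proof.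
move=> /sv_leP h1 /sv_leP h2; apply/sv_leP => i iX; rewrite h1 // h2 //.
by have := iX; rewrite !inE h1.
Qed.

Lemma sv_oppK : involutive sv_opp.
Proof. by move=> X; apply/ffunP => i; rewrite !ffunE; case: (X i) => [[]|]. Qed.

Lemma sv_supp_opp X : sv_supp (sv_opp X) = sv_supp X.
Proof. by apply/setP => i; rewrite !inE ffunE; case: (X i). Qed.

Lemma sv_set_opp X j : sv_set (sv_opp X) j None = sv_opp (sv_set X j None).
Proof. by apply/ffunP => i; rewrite !ffunE; case: (i == j). Qed.

Lemma sv_supp_del X j : sv_supp (sv_set X j None) = sv_supp X :\ j.
Proof. by apply/setP => i; rewrite !inE ffunE; case: (i == j). Qed.

Lemma sv_del_le X j : sv_le (sv_set X j None) X.
Proof.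
by apply/sv_leP => i; rewrite sv_supp_del !inE ffunE => /andP[/negbTE ->].
Qed.

Variables (L : finType) (neg : L -> L) (lam : signvec -> L).
Hypotheses (negK : involutive neg)
  (lam_opp : forall X, sv_supp X != set0 -> lam (sv_opp X) = neg (lam X))
  (lam_le : forall X Y, sv_supp X != set0 -> sv_le X Y -> lam Y <> neg (lam X)).

(* The image under [lam] of the fundamental chain of the barycentric
   subdivision of the simplex [X]. *)
Fixpoint chain_of (k : nat) (X : signvec) : chain L :=
  if k is k'.+1 then
    cone (lam X) (\sum_(j in sv_supp X) chain_of k' (sv_set X j None))
  else pt L.

Lemma card_supp_del X j k :
  #|sv_supp X| = k.+1 -> j \in sv_supp X -> #|sv_supp (sv_set X j None)| = k.
Proof.
by move=> hX jX; move: hX; rewrite sv_supp_del (cardsD1 j) jX => -[].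
Qed.

(** This makes [lam] a chain map. By [bd_cone] the error term is a cone over the boundary of the sum
    of the facet chains; by induction that boundary runs over ordered pairs of deleted coordinates,
    which cancel mod 2. *)
Lemma bd_chain_of k X : #|sv_supp X| = k.+1 ->
  bd (chain_of k.+1 X) = \sum_(j in sv_supp X) chain_of k (sv_set X j None).
Proof.
elim: k X => [|k IH] X hX; rewrite [chain_of _ _]/= bd_cone.
  rewrite bd_sum [X in cone _ X]big1 ?cone0 ?addr0 // => j _; exact: bd_pt.
rewrite -[RHS]addr0; congr (_ + _).
rewrite bd_sum (eq_bigr _ (fun j jX => IH _ (card_supp_del hX jX))).
set G := (X in cone _ X); suff -> : G = 0 by rewrite cone0.
pose F i j := if [&& i \in sv_supp X, j \in sv_supp X & i != j]
  then chain_of k (sv_set (sv_set X i None) j None) else 0.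
transitivity (\sum_i \sum_j F i j); last first.
  apply: symmetric_sum0 => [|i|i j]; first exact: chain_addrr.
    by rewrite /F eqxx !andbF.
  rewrite /F eq_sym andbCA; case: ifP => // _; congr (chain_of _ _).
  by apply/ffunP => l; rewrite !ffunE; do 2!case: (l == _).
rewrite /G big_mkcond; apply: eq_bigr => i _; rewrite /F.
case: (boolP (i \in sv_supp X)) => [iX|/negbTE iX]; last by rewrite big1.
rewrite sv_supp_del big_mkcond; apply: eq_bigr => j _.
by rewrite !inE [j == i]eq_sym /= andbC; case: ifP.
Qed.

Lemma chain_of_opp k X : #|sv_supp X| = k ->
  chain_of k (sv_opp X) = nu neg (chain_of k X).
Proof.
elim: k X => [|k IH] X hX; first by rewrite /= nu_pt.
rewrite /= nu_cone // lam_opp -?card_gt0 ?hX // sv_supp_opp nu_sum.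
congr (cone _ _); apply: eq_bigr => j jX.
by rewrite sv_set_opp IH // (card_supp_del hX).
Qed.

Definition nocomp (s : {set L}) := [forall l in s, neg l \notin s].
Definition admissible k (c : chain L) :=
  forall s, c s -> nocomp s /\ #|s| = k.

(** The induction carries the origin of each label: it comes from a nonzero [Y] below [X], so
    [lam_le] prevents its antipode from being the apex [lam X]. *)
Lemma chain_of_labels k X s : #|sv_supp X| = k -> chain_of k X s ->
  [/\ nocomp s, #|s| = k & forall l, l \in s ->
       exists Y, [/\ sv_supp Y != set0, sv_le Y X & lam Y = l]].
Proof.
elim: k X s => [|k IH] X s hX /=.
  rewrite ffunE => /eqP ->; split; rewrite ?cards0 //.
    by apply/forallP => l; rewrite inE.
  by move=> l; rewrite inE.
rewrite ffunE; case: ifPn => // ls; rewrite sum_ffunE => h.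
have [j jX hj] : exists2 j, j \in sv_supp X
   & chain_of k (sv_set X j None) (s :\ lam X).
  apply: contrapT => no; move: h; rewrite big1 // => j jX.
  by apply/negbTE/negP => hj; apply: no; exists j.
have [h1 h2 h3] := IH _ _ (card_supp_del hX jX) hj.
have X0 : sv_supp X != set0 by rewrite -card_gt0 hX.
have lab l : l \in s -> exists Y, [/\ sv_supp Y != set0, sv_le Y X & lam Y = l].
  have [->|ll lin] := eqVneq l (lam X); first by exists X; rewrite sv_le_refl.
  have [|Y [Y0 YX <-]] := h3 l; first by rewrite !inE ll.
  by exists Y; split=> //; apply: sv_le_trans YX (sv_del_le _ _).
have negX l : l \in s -> neg l != lam X.
  move=> /lab[Y [Y0 YX <-]]; apply/eqP => e; exact: (lam_le Y0 YX).
split=> //; last by rewrite (cardsD1 (lam X)) ls h2.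
apply/forallP => l; apply/implyP => lin; apply/negP => nlin.
have [e|ll] := eqVneq l (lam X).
  by have := negX _ nlin; rewrite negK e eqxx.
move/forallP/(_ l): h1; rewrite !inE ll lin /=.
by rewrite nlin andbT negbK; apply/negP/negX.
Qed.

Lemma chain_of_admissible k X : #|sv_supp X| = k -> admissible k (chain_of k X).
Proof. by move=> hX s /(chain_of_labels hX)[]. Qed.

Lemma admissibleD k c d : admissible k c -> admissible k d -> admissible k (c + d).
Proof.
move=> hc hd s; rewrite ffunE; case cs: (c s); first by have := hc _ cs.
by case ds: (d s) => //; have := hd _ ds.
Qed.

Lemma admissible0 k : admissible k 0.
Proof. by move=> s; rewrite ffunE. Qed.

Lemma admissible_bd k c : admissible k.+1 c -> admissible k (bd c).
Proof.
move=> hc t; rewrite ffunE => h.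
have [l lt /hc [h1 h2]] : exists2 l, l \notin t & c (l |: t).
  apply: contrapT => no; move: h; rewrite big1 // => l lt.
  by apply/negbTE/negP => hl; apply: no; exists l.
split; last by move: h2; rewrite cardsU1 lt => -[].
apply/forallP => x; apply/implyP => xt; move/forallP/(_ x): h1.
by rewrite !inE xt orbT /= negb_or => /andP[].
Qed.

(* The antipode acts freely on the admissible simplices, so invariant chains
   are norms. *)
Lemma invariant_norm k c : admissible k.+1 c -> nu neg c = c ->
  exists g, admissible k.+1 g /\ c = g + nu neg g.
Proof.
move=> hc nc.
pose rep (s : {set L}) := (enum_rank s < enum_rank (neg @: s))%N.
exists [ffun s : {set L} => c s && rep s]; split.
  by move=> s; rewrite ffunE => /andP[/hc].
apply/ffunP => s; rewrite !ffunE.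
have -> : c (neg @: s) = c s by rewrite -[in RHS]nc ffunE.
case cs: (c s) => //=; have [ns sk] := hc _ cs.
have sn : s != neg @: s.
  have /set0Pn[l ls] : s != set0 by rewrite -card_gt0 sk.
  apply/eqP => e; move/forallP/(_ l): ns.
  by rewrite ls -mem_imneg // -e ls.
rewrite /rep imneg_inv //; case: ltngtP => // /val_inj/enum_rank_inj e.
by rewrite -e eqxx in sn.
Qed.

Lemma nocomp_card s : nocomp s -> (2 * #|s| <= #|L|)%N.
Proof.
move=> ns; have d : [disjoint s & neg @: s].
  rewrite disjoint_subset; apply/subsetP => l ls; rewrite inE mem_imneg //.
  by move/forallP/(_ l): ns; rewrite ls.
rewrite mul2n -addnn -{2}(card_imset s (inv_inj negK)).
by rewrite -cardsUI (disjoint_setI0 d) cards0 addn0 max_card.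
Qed.

Definition sv_flip (X : signvec) (j : 'I_m) : signvec := sv_set X j (omap negb (X j)).

Lemma sv_flipK j : involutive (sv_flip^~ j).
Proof.
by move=> X; apply/ffunP => i; rewrite !ffunE eqxx; case: (eqVneq i _) => // ->; case: (X j) => [[]|].
Qed.

Lemma sv_supp_flip X j : sv_supp (sv_flip X j) = sv_supp X.
Proof.
by apply/setP => i; rewrite !inE ffunE; case: (eqVneq i _) => // ->; case: (X j).
Qed.

Definition initial_set (s : nat) : {set 'I_m} := [set i : 'I_m | (i < s)%N].

Lemma initial_setS (k : 'I_m) : initial_set k.+1 = k |: initial_set k.
Proof. by apply/setP => i; rewrite !inE ltnS leq_eqVlt. Qed.

Lemma notin_initial (k : 'I_m) : k \notin initial_set k.
Proof. by rewrite inE ltnn. Qed.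

Lemma card_initial (s : nat) : (s <= m)%N -> #|initial_set s| = s.
Proof.
elim: s => [|s IH] hs; first by apply/eqP; rewrite cards_eq0; apply/eqP/setP => i; rewrite !inE.
have := initial_setS (Ordinal hs); rewrite /= => ->.
by rewrite cardsU1 (notin_initial (Ordinal hs)) IH // ltnW.
Qed.

(** Images of the fundamental cycle of the boundary of the cross-polytope on the first [s]
    coordinates and, for [hemisphere k], of its half where coordinate [k] is positive, with equator
    [sphere k]. *)
Definition sphere s := \sum_(X | sv_supp X == initial_set s) chain_of s X.
Definition hemisphere (k : 'I_m) :=
  \sum_(X | (sv_supp X == initial_set k.+1) && (X k == Some true)) chain_of k.+1 X.

Lemma sphere_hemisphere (k : 'I_m) :
  sphere k.+1 = hemisphere k + nu neg (hemisphere k).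
Proof.
rewrite /sphere (bigID (fun X : signvec => X k == Some true)) /=; congr (_ + _).
rewrite (reindex_inj (inv_inj sv_oppK)) nu_sum; apply: eq_big => [X|X].
  rewrite sv_supp_opp ffunE; case: eqP => //= /setP/(_ k).
  by rewrite !inE ltnSn; case: (X k) => [[]|].
move=> /andP[/eqP]; rewrite {1}sv_supp_opp => hX _; apply: (@chain_of_opp k.+1).
by rewrite hX card_initial.
Qed.

Lemma bd_hemisphere (k : 'I_m) : bd (hemisphere k) = sphere k.
Proof.
rewrite bd_sum.
transitivity (\sum_(j in initial_set k.+1)
  \sum_(X | (sv_supp X == initial_set k.+1) && (X k == Some true))
     chain_of k (sv_set X j None)).
  rewrite [RHS]exchange_big; apply: eq_bigr => X /andP[/eqP hX _].
  by rewrite bd_chain_of hX ?card_initial.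
(* Deleting [k] gives the equator. For [j != k], [X] and [sv_flip X j] lie in the same hemisphere
   and become equal when [j] is deleted, so their terms cancel. *)
rewrite (bigD1 k) ?inE ?ltnSn //= [X in _ + X]big1 ?addr0 => [|j /andP[jk jnk]].
  rewrite (reindex_onto (fun Y => sv_set Y k (Some true)) (fun X => sv_set X k None)).
    apply: eq_big => [Y|Y].
      rewrite ffunE !eqxx andbT; apply/andP/eqP => [[/eqP/setP h /eqP e]|h].
        have Yk : Y k = None by rewrite -e !ffunE eqxx.
        apply/setP => i; move: (h i); rewrite !inE !ffunE ltnS leq_eqVlt.
        case: (eqVneq i k) => [->|ik]; first by rewrite Yk ltnn.
        by rewrite (_ : (i == k :> nat) = false) //; apply/negbTE.
      have Yk : Y k = None by apply/sv_suppP; rewrite h notin_initial.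
      split; apply/eqP.
        rewrite initial_setS -h; apply/setP => i; rewrite !inE !ffunE.
        by case: (eqVneq i _).
      by apply/ffunP => i; rewrite !ffunE; case: (eqVneq i _) => // ->.
    move=> /andP[_ /eqP e]; congr (chain_of _ _).
    by rewrite -{2}e.
  move=> X /andP[_ /eqP e]; apply/ffunP => i; rewrite !ffunE.
  by case: (eqVneq i _) => // ->.
rewrite (bigID (fun X : signvec => X j == Some true)) /=.
rewrite [X in _ + X](reindex_inj (inv_inj (sv_flipK j))) /=.
set T := (X in _ + X); set S := (X in X + _).
suff -> : T = S by exact: chain_addrr.
apply: eq_big => [X|X _]; last first.
  by congr (chain_of _ _); apply/ffunP => i; rewrite !ffunE; case: (i == j).
rewrite sv_supp_flip !ffunE eqxx [k == j]eq_sym (negbTE jnk) andbAC [RHS]andbAC -!andbA.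
case: (boolP (sv_supp X == _)) => //= /eqP hX; congr (_ && _).
by move/setP/(_ j): hX; rewrite jk inE; case: (X j) => [[]|].
Qed.

(** A chain-level Borsuk-Ulam argument, downward in dimension: with fewer than [2 * m] labels, every
    sphere is [c + nu neg c] with [c] the boundary of an admissible chain. At dimension -1 this
    fails: [sphere 0] has coefficient 1 at the empty simplex, and [c + nu neg c] has coefficient
    0. *)
Lemma octahedral_tucker : (2 * m <= #|L|)%N.
Proof.
rewrite leqNgt; apply/negP => small.
have key d : (d <= m)%N -> exists g, admissible (m - d).+1 g /\
    sphere (m - d) = bd g + nu neg (bd g).
  elim: d => [|d IH] hd.
    (* At the top the sphere itself vanishes: its simplices would consist of [m] labels without
       antipodal pairs, too many for [L]. *)
    exists 0; split; first exact: admissible0.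
    rewrite subn0 bd0 nu0 addr0 /sphere big1 // => X /eqP hX.
    apply/ffunP => s; rewrite [RHS]ffunE; apply/negbTE/negP => hs.
    have hc : #|sv_supp X| = m by rewrite hX card_initial.
    have [/nocomp_card ns sm] := chain_of_admissible hc hs.
    by move: small; rewrite ltnNge -{1}sm ns.
  have [g [ag zg]] := IH (ltnW hd).
  have lt : (m - d.+1 < m)%N by rewrite -subn_gt0 subKn.
  pose k := Ordinal lt.
  have e : (m - d = k.+1)%N by rewrite /= subnSK.
  rewrite e in ag zg.
  (* The same sphere is the norm of [hemisphere k] and of [bd g], so their sum [u] is invariant and
     hence a norm. The boundary of [u] is that of the hemisphere, which is the next sphere down. *)
  pose u := hemisphere k + bd g.
  have au : admissible k.+1 u.
    apply: admissibleD; last exact: admissible_bd.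
    move=> s; rewrite sum_ffunE => h.
    have [X /andP[/eqP hX _] hs] : exists2 X : signvec,
        (sv_supp X == initial_set k.+1) && (X k == Some true) & chain_of k.+1 X s.
      apply: contrapT => no; move: h; rewrite big1 // => X hX.
      by apply/negbTE/negP => hs; apply: no; exists X.
    by apply: chain_of_admissible hs; rewrite hX card_initial.
  have iu : nu neg u = u.
    rewrite /u nuD; move: zg; rewrite sphere_hemisphere => zg.
    move: (hemisphere k) (bd g) (nu neg (hemisphere k)) (nu neg (bd g)) zg => z w x y /ffunP h.
    apply/ffunP => t; move: (h t); rewrite !ffunE.
    change (addb (z t) (x t) = addb (w t) (y t) -> addb (x t) (y t) = addb (z t) (w t)).
    by case: (x t); case: (y t); case: (z t); case: (w t).
  have [g' [ag' eg']] := invariant_norm au iu.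
  exists g'; split=> //.
  rewrite -[(m - d.+1)%N]/(nat_of_ord k) -bd_hemisphere.
  by rewrite -[LHS]addr0 -(bd_bd g) -bdD -/u {1}eg' bdD nu_bd.
have [g [ag zg]] := key m (leqnn _).
move: zg; rewrite subnn => /ffunP/(_ set0).
rewrite !ffunE imset0 /sphere sum_ffunE.
rewrite (bigD1 [ffun=> None]) /=; last first.
  by apply/eqP/setP => i; rewrite !inE ffunE.
rewrite ffunE eqxx big1 => [|X /andP[/eqP/setP hX /eqP []]].
  by set y := \sum_(_ | _) _; case: y.
by apply/ffunP => i; rewrite ffunE; apply/sv_suppP; rewrite hX inE.
Qed.

End SignVectors.

(** * Sarkaria's bound for linear subspaces *)

Definition pos_part (R : rcfType) m (x : 'rV[R]_m) : {set 'I_m} :=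
  [set i | 0 < x 0 i].
Definition neg_part (R : rcfType) m (x : 'rV[R]_m) : {set 'I_m} :=
  [set i | x 0 i < 0].

Section LinearSarkaria.
Variables (R : rcfType) (m q : nat) (Phi : 'M[R]_(m, q)).

Definition sgv (x : 'rV[R]_m) : signvec m :=
  [ffun i => if 0 < x 0 i then Some true
             else if x 0 i < 0 then Some false else None].

Lemma sgv_true x i : (sgv x i == Some true) = (0 < x 0 i).
Proof. by rewrite ffunE; case: ltgtP. Qed.

Lemma sgv_false x i : (sgv x i == Some false) = (x 0 i < 0).
Proof. by rewrite ffunE; case: ltgtP. Qed.

Lemma sgv_none x i : (sgv x i == None) = (x 0 i == 0).
Proof. by rewrite ffunE; case: ltgtP. Qed.

Lemma sgvN x : sgv (- x) = sv_opp (sgv x).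
Proof. by apply/ffunP => i; rewrite !ffunE mxE oppr_gt0 oppr_lt0; case: ltgtP. Qed.

Lemma sgv_eqP (x : 'rV[R]_m) (X : signvec m) : (forall i, X i = Some true -> 0 < x 0 i) ->
  (forall i, X i = Some false -> x 0 i < 0) -> (forall i, X i = None -> x 0 i = 0) ->
  sgv x = X.
Proof.
move=> h1 h2 h3; apply/ffunP => i; case E : (X i) => [[]|].
- by apply/eqP; rewrite sgv_true h1.
- by apply/eqP; rewrite sgv_false h2.
- by apply/eqP; rewrite sgv_none h3.
Qed.

Lemma sgv_cone x y t u : sv_le (sgv x) (sgv y) -> 0 <= t -> 0 < u ->
  sgv (t *: x + u *: y) = sgv y.
Proof.
move=> /forallP xy t0 u0; apply: sgv_eqP => i yi; rewrite !mxE; have := xy i; rewrite yi.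
- have {}yi : 0 < y 0 i by rewrite -sgv_true yi.
  rewrite sgv_none sgv_true => h; apply: ltr_wpDl; last by rewrite mulr_gt0.
  by case/orP: h => [/eqP->|/ltW h]; rewrite ?mulr0 ?mulr_ge0.
- have {}yi : y 0 i < 0 by rewrite -sgv_false yi.
  rewrite sgv_none sgv_false => h; apply: ltr_wnDl; last by rewrite pmulr_rlt0.
  by case/orP: h => [/eqP->|/ltW h]; rewrite ?mulr0 ?mulr_ge0_le0.
- have {}yi : y 0 i = 0 by apply/eqP; rewrite -sgv_none yi.
  by rewrite orbb sgv_none yi => /eqP ->; rewrite !mulr0 addr0.
Qed.

Definition flag (s : nat) (x : 'rV[R]_m) : Prop :=
  forall k : 'I_q, (k < s)%N -> (x *m Phi) 0 k = 0.
Definition realised (s : nat) (X : signvec m) : Prop :=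
  exists x, flag s x /\ sgv x = X.

Lemma flagS (k : 'I_q) x : flag k x -> (x *m Phi) 0 k = 0 -> flag k.+1 x.
Proof.
move=> h e l; rewrite ltnS leq_eqVlt => /orP[/eqP/val_inj ->|] //; exact: h.
Qed.

Lemma mulmx_comb (x y : 'rV[R]_m) t u k :
  ((t *: x + u *: y) *m Phi) 0 k = t * (x *m Phi) 0 k + u * (y *m Phi) 0 k.
Proof. by rewrite mulmxDl -!scalemxAl mxE [in LHS]mxE [X in _ + X]mxE. Qed.

Lemma flag_comb s x y t u : flag s x -> flag s y -> flag s (t *: x + u *: y).
Proof. by move=> hx hy k ks; rewrite mulmx_comb hx // hy // !mulr0 addr0. Qed.

Lemma flagN s x : flag s x -> flag s (- x).
Proof. by move=> h k ks; rewrite mulNmx mxE h // oppr0. Qed.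

Lemma realised_opp s X : realised s X -> realised s (sv_opp X).
Proof. by case=> x [hx <-]; exists (- x); split; [exact: flagN | exact: sgvN]. Qed.

Lemma realised0 X : realised 0 X.
Proof.
exists (\row_i (if X i is Some b then (if b then 1 else -1) else 0)); split=> //.
by apply: sgv_eqP => i h; rewrite mxE h ?ltr01 ?ltrN10.
Qed.

(* Moving from [y] along [x] keeps the sign vector and crosses the hyperplane. *)
Lemma realised_next (k : 'I_q) x y : flag k x -> flag k y ->
    sv_le (sgv x) (sgv y) -> (x *m Phi) 0 k * (y *m Phi) 0 k < 0 ->
  realised k.+1 (sgv y).
Proof.
move=> hx hy xy; set a := (x *m Phi) 0 k; set b := (y *m Phi) 0 k => ab.
exists (`|b| *: x + `|a| *: y); split; last first.
  apply: sgv_cone => //; rewrite normr_gt0; apply: contraTneq ab => ->.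
  by rewrite mul0r ltxx.
apply: flagS; first exact: flag_comb.
rewrite mulmx_comb -/a -/b.
case: (ltgtP a 0) ab => [a0|a0|->]; last by rewrite mul0r ltxx.
  by rewrite nmulr_rlt0 // => b0; rewrite gtr0_norm // ltr0_norm // mulNr mulrC subrr.
by rewrite pmulr_rlt0 // => b0; rewrite ltr0_norm // gtr0_norm // mulNr mulrC addNr.
Qed.

Variables (C : finType) (bad : C -> {set 'I_m} -> bool).
Hypothesis bad_meet : forall c (U U' : {set 'I_m}),
  bad c U -> bad c U' -> ~~ [disjoint U & U'].
Hypothesis bad_ex : forall x, x != 0 -> x *m Phi = 0 ->
  exists c, bad c (pos_part x) || bad c (neg_part x).

Definition sv_pos (X : signvec m) : {set 'I_m} := [set i | X i == Some true].
Definition sv_neg (X : signvec m) : {set 'I_m} := [set i | X i == Some false].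

Let label := (bool * ('I_q + C))%type.
Let flip (l : label) : label := (~~ l.1, l.2).

(* A sign vector that [ker Phi] does not realise is labelled by the first
   hyperplane of the flag losing it, and by the side of it on which it lies. *)
Definition exit_level (X : signvec m) (s : 'I_q) :=
  `[< realised s X /\ ~ realised s.+1 X >].
Definition exit_side (X : signvec m) (s : 'I_q) :=
  `[< exists x, [/\ flag s x, sgv x = X & 0 < (x *m Phi) 0 s] >].
Definition colour (X : signvec m) (c : C) := bad c (sv_pos X) || bad c (sv_neg X).

(** Exit levels take precedence, so colours serve only the sign vectors of elements of the kernel of
    [Phi]. By [colour_ex] the default [l0] can occur only at the zero sign vector. *)
Definition labelling (l0 : label) (X : signvec m) : label :=
  if [pick s | exit_level X s] is Some s then (exit_side X s, inl s)
  else if [pick c | colour X c] is Some c then (bad c (sv_pos X), inr c) else l0.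

Lemma sv_pos_opp X : sv_pos (sv_opp X) = sv_neg X.
Proof. by apply/setP => i; rewrite !inE ffunE; case: (X i) => [[]|]. Qed.

Lemma sv_neg_opp X : sv_neg (sv_opp X) = sv_pos X.
Proof. by apply/setP => i; rewrite !inE ffunE; case: (X i) => [[]|]. Qed.

Lemma bad_pos_neg c X : colour X c -> bad c (sv_neg X) = ~~ bad c (sv_pos X).
Proof.
rewrite /colour; case hp: (bad c (sv_pos X)) => //= _; apply/negP => hn.
have := bad_meet hp hn; rewrite disjoint_subset.
by move/negP; apply; apply/subsetP => i; rewrite !inE => /eqP->.
Qed.

Lemma exit_level_opp X : exit_level (sv_opp X) =1 exit_level X.
Proof.
suff h Y s : exit_level Y s -> exit_level (sv_opp Y) s.
  by move=> s; apply/idP/idP => /h //; rewrite sv_oppK.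
move=> /asboolP [h1 h2]; apply/asboolP; split; first exact: realised_opp.
by move=> /realised_opp; rewrite sv_oppK.
Qed.

(** The side does not depend on the representative: two vectors with sign vector [X] on opposite
    sides would combine, by [realised_next], to one on the hyperplane, and [X] would not be lost
    there. *)
Lemma exit_side_opp X s : exit_level X s -> exit_side (sv_opp X) s = ~~ exit_side X s.
Proof.
move=> /asboolP [[x [hx ex]] nX].
have nz : (x *m Phi) 0 s != 0.
  by apply/eqP => e; apply: nX; exists x; split=> //; apply: flagS.
apply/idP/idP => [/asboolP [y [hy ey py]]|].
  apply/negP => /asboolP [z [hz ez pz]]; apply: nX.
  rewrite -ez; apply: (@realised_next s (- y) z) => //; first exact: flagN.
    by rewrite sgvN ey sv_oppK ez; apply: sv_le_refl.
  by rewrite mulNmx mxE pmulr_llt0 // oppr_lt0.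
move/asboolP => no; apply/asboolP; exists (- x); split; first exact: flagN.
  by rewrite sgvN ex.
rewrite mulNmx mxE oppr_gt0; case: ltgtP nz => // h _.
by case: no; exists x.
Qed.

Lemma colour_ex X : sv_supp X != set0 -> (forall s, exit_level X s = false) ->
  exists c, colour X c.
Proof.
move=> X0 no.
have rX (s : nat) : (s <= q)%N -> realised s X.
  elim: s => [|s IH] hs; first exact: realised0.
  apply: contrapT => nr; have := no (Ordinal hs).
  by move/asboolP; apply; split=> //; apply: IH; rewrite ltnW.
have [x [hx ex]] := rX q (leqnn _).
have [||c hc] := bad_ex (x := x).
- apply: contraNneq X0 => x0; apply/eqP/setP => i; rewrite !inE -ex sgv_none x0 mxE.
  by rewrite eqxx.
- by apply/rowP => k; rewrite hx // mxE.
exists c; move: hc; rewrite /colour.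
have -> : pos_part x = sv_pos X by apply/setP => i; rewrite !inE -ex sgv_true.
by have -> : neg_part x = sv_neg X by apply/setP => i; rewrite !inE -ex sgv_false.
Qed.

Inductive labelling_spec (X : signvec m) : label -> Prop :=
| ExitLabel s of exit_level X s : labelling_spec X (exit_side X s, inl s)
| ColourLabel c of colour X c : labelling_spec X (bad c (sv_pos X), inr c).

Lemma labellingP l0 X : sv_supp X != set0 -> labelling_spec X (labelling l0 X).
Proof.
move=> X0; rewrite /labelling; case: pickP => [s hs|no]; first exact: ExitLabel.
case: pickP => [c hc|noc]; first exact: ColourLabel.
by have [c] := colour_ex X0 no; rewrite noc.
Qed.

Lemma labelling_opp l0 X : sv_supp X != set0 ->
  labelling l0 (sv_opp X) = flip (labelling l0 X).
Proof.
move=> X0; rewrite /labelling (eq_pick (exit_level_opp X)).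
case: pickP => [s hs|no]; first by rewrite /flip exit_side_opp.
rewrite (@eq_pick _ _ (colour X)) => [|c]; last first.
  by rewrite /colour sv_pos_opp sv_neg_opp orbC.
case: pickP => [c hc|noc].
  by rewrite /flip /= sv_pos_opp bad_pos_neg.
by have [c] := colour_ex X0 no; rewrite noc.
Qed.

(** After passing to opposites if necessary, [Z] below [T] carry the same level or colour with signs
    plus and minus. For a level, [realised_next] moves [T] onto the hyperplane that was to lose it.
    For a colour, the positive part of [Z] and the negative part of [T] are disjoint and both
    bad. *)
Lemma labelling_le l0 X Y : sv_supp X != set0 -> sv_le X Y ->
  labelling l0 Y <> flip (labelling l0 X).
Proof.
move=> X0 XY.
have Y0 : sv_supp Y != set0.
  case/set0Pn: X0 => i iX; apply/set0Pn; exists i.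
  by move: (iX); rewrite !inE (sv_leP _ _ XY i iX).
suff h Z T l : sv_supp Z != set0 -> sv_supp T != set0 -> sv_le Z T ->
    labelling l0 T = (false, l) -> labelling l0 Z <> (true, l).
  case E : (labelling l0 X) => [[] l] /= F; first exact: h F E.
  have [] := h (sv_opp X) (sv_opp Y) l.
  - by rewrite sv_supp_opp.
  - by rewrite sv_supp_opp.
  - apply/sv_leP => i; rewrite sv_supp_opp => iX.
    by rewrite !ffunE (sv_leP _ _ XY i iX).
  - by rewrite labelling_opp // F.
  - by rewrite labelling_opp // E.
move=> Z0 T0 ZT.
case: (labellingP l0 T0) => [s hs|c hc] [e1 e2]; subst l;
  case: (labellingP l0 Z0) => [s' hs'|c' hc'] [e3] // e4; subst.
- move: e1 e3; rewrite /exit_side => /asboolP no /asboolP [x [hx ex px]].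
  case/asboolP: hs => [[y [hy ey]] nT].
  have ny : (y *m Phi) 0 s < 0.
    rewrite ltNge le_eqVlt negb_or; apply/andP; split.
      rewrite eq_sym; apply/eqP => e; apply: nT; exists y; split=> //.
      exact: flagS.
    by apply/negP => py; apply: no; exists y.
  apply: nT; rewrite -ey; apply: realised_next hx hy _ _; first by rewrite ex ey.
  by rewrite pmulr_rlt0.
- have := bad_meet e3 (_ : bad c (sv_neg T)).
  rewrite bad_pos_neg // e1 => /(_ isT)/negP; apply.
  rewrite disjoint_subset; apply/subsetP => i; rewrite !inE => /eqP Zi.
  by rewrite -(sv_leP _ _ ZT) ?inE ?Zi.
Qed.

Lemma linear_sarkaria : (m <= q + #|C|)%N.
Proof.
case: (posnP m) => [->//|m0].
have [l0] : exists l0 : label, true.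
  have [X X0] : exists X : signvec m, sv_supp X != set0.
    exists [ffun=> Some true]; apply/set0Pn; exists (Ordinal m0).
    by rewrite inE ffunE.
  have [[s _]|no] := pselect (exists s, exit_level X s); first by exists (true, inl s).
  have [|c _] := colour_ex X0; last by exists (true, inr c).
  by move=> s; apply/negbTE/negP => hs; apply: no; exists s.
have flipK : involutive flip by case=> b l; rewrite /flip /= negbK.
move=> _; have := octahedral_tucker flipK (@labelling_opp l0) (@labelling_le l0).
by rewrite card_prod card_bool card_sum card_ord leq_pmul2l.
Qed.

End LinearSarkaria.

(** * Kneser colouring of the non-faces *)

Lemma take_subset (T : finType) (S : {set T}) (s : nat) :
  exists D : {set T}, D \subset S /\ #|D| = minn s #|S|.
Proof.
exists [set x in take s (enum S)]; split.
  by apply/subsetP => x; rewrite inE => /mem_take; rewrite mem_enum.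
rewrite cardsE (card_uniqP _) ?take_uniq ?enum_uniq // size_take_min -cardE.
by [].
Qed.

Section Blocks.
Variables (m r : nat) (blk : 'I_m -> 'I_r).

Definition block (i : 'I_r) : {set 'I_m} := [set j | blk j == i].
(* The union of the sets [U_i] of vertices of faces of the simplices has
   dimension [#|U| - r] if all [U_i] are nonempty; [excess] extends this to
   partial unions. *)
Definition excess (U : {set 'I_m}) : nat := (\sum_i (#|U :&: block i|).-1)%N.

Lemma card_blocks (P : pred 'I_r) (U : {set 'I_m}) :
  #|[set j in U | P (blk j)]| = (\sum_(i | P i) #|U :&: block i|)%N.
Proof.
rewrite -sum1_card (partition_big blk P) => [|j]; last by rewrite inE => /andP[].
apply: eq_bigr => i Pi; rewrite -sum1_card; apply: eq_bigl => j.
by rewrite !inE; case: eqVneq => [->|]; rewrite ?Pi ?andbT ?andbF.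
Qed.

Lemma card_all_blocks (U : {set 'I_m}) : #|U| = (\sum_i #|U :&: block i|)%N.
Proof.
by rewrite -card_blocks; congr #|pred_of_set _|; apply/setP => j; rewrite inE andbT.
Qed.

Lemma excess_sub (U U' : {set 'I_m}) : U \subset U' -> (excess U <= excess U')%N.
Proof.
move=> UU'; apply: leq_sum => i _; rewrite -!subn1 leq_sub2r //.
exact/subset_leq_card/setSI.
Qed.

End Blocks.

Section ColourBound.
Variables (R : rcfType) (m r : nat) (blk : 'I_m -> 'I_r) (n : 'I_r -> nat).
Hypotheses (card_block : forall i, #|block blk i| = (n i).+1)
  (n_gt0 : forall i, (0 < n i)%N).
Variables (k p : nat) (M : 'M[R]_(p, m)).
(** In the application [M] is the Gale dual, [U] collects the factor vertices of a face of dimension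
    at most [k], and the complement of [U] indexes the facets containing that face. *)
Hypothesis balanced : forall U : {set 'I_m},
  (forall i, exists2 j, j \in U & blk j = i) -> (#|U| <= k + r)%N ->
  exists lam : 'I_m -> R, (forall j, j \notin U -> 0 < lam j) /\
    forall x : 'rV[R]_m, (x <= M)%MS -> \sum_(j | j \notin U) lam j * x 0 j = 0.

(** Empty blocks and singletons both contribute 0 to [excess], so each empty block can receive one
    element, and it can avoid [j0] because every block has at least two elements. *)
Lemma extend_transversal (U : {set 'I_m}) j0 : j0 \notin U -> (excess blk U <= k)%N ->
  exists U' : {set 'I_m}, [/\ U \subset U', j0 \notin U',
    forall i, exists2 j, j \in U' & blk j = i & (#|U'| <= k + r)%N].
Proof.
move=> j0U hU.
have /choice[pk hpk] : forall i, exists j, blk j = i /\ j != j0.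
  move=> i; have : (0 < #|block blk i :\ j0|)%N.
    have := cardsD1 j0 (block blk i); rewrite card_block => e.
    by move: (n_gt0 i); rewrite -ltnS e; case: (_ \in _); rewrite ?add1n ?ltnS // => /ltnW.
  by rewrite card_gt0 => /set0Pn[j]; rewrite !inE => /andP[? /eqP]; exists j.
pose U' := U :|: [set pk i | i in [set i | U :&: block blk i == set0]].
exists U'; split.
- exact: subsetUl.
- rewrite inE (negbTE j0U) /=; apply/imsetP => -[i _ e].
  by have [_] := hpk i; rewrite e eqxx.
- move=> i; have [e|/set0Pn[j]] := eqVneq (U :&: block blk i) set0.
    exists (pk i); last by case: (hpk i).
    by rewrite !inE; apply/orP; right; apply: imset_f; rewrite inE e.
  by rewrite !inE => /andP[jU /eqP]; exists j; rewrite ?inE ?jU.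
- rewrite (card_all_blocks blk).
  apply: (@leq_trans (\sum_(i < r) ((#|U :&: block blk i|).-1 + 1))%N); last first.
    by rewrite big_split /= sum1_card card_ord leq_add2r.
  apply: leq_sum => i _; have [e|ne] := eqVneq (U :&: block blk i) set0.
    rewrite e cards0 /= -(cards1 (pk i)); apply/subset_leq_card/subsetP => j.
    rewrite !inE => /andP[/orP[jU|/imsetP[i' _ ->]] /eqP ji].
      by have := in_set0 j; rewrite -e !inE jU ji eqxx.
    by case: (hpk i') => <- _; rewrite ji.
  rewrite addn1 prednK ?card_gt0 //; apply/subset_leq_card/subsetP => j.
  rewrite !inE => /andP[/orP[->//|/imsetP[i' + ->]] /eqP ji].
  have -> : i' = i by rewrite -ji; case: (hpk i').
  by rewrite inE (negbTE ne).
Qed.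

(* A negative coordinate could be kept out of the face supporting the positive
   part, and would make the balanced combination negative. *)
Lemma small_pos_part_ge0 (x : 'rV[R]_m) : (x <= M)%MS ->
  (excess blk (pos_part x) <= k)%N -> forall j, 0 <= x 0 j.
Proof.
move=> xM ex j; rewrite leNgt; apply/negP => xj.
have [|U [xU jU tU cU]] := extend_transversal (j0 := j) _ ex.
  by rewrite inE -leNgt ltW.
have [lam [lam0 /(_ _ xM)]] := balanced tU cU.
apply/eqP; rewrite (bigD1 j) //= lt_eqF //.
apply: ltr_wnDr; last by rewrite pmulr_rlt0 ?lam0.
apply: sumr_le0 => l /andP[lU _]; rewrite pmulr_rle0 ?lam0 // leNgt.
by apply: contra lU => xl; apply: (subsetP xU); rewrite inE.
Qed.

Lemma small_pos_part_eq0 (x : 'rV[R]_m) : (x <= M)%MS ->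
  (excess blk (pos_part x) <= k)%N -> x = 0.
Proof.
move=> xM ex; have x0 := small_pos_part_ge0 xM ex.
have x0' : forall j, 0 <= (- x) 0 j.
  apply: small_pos_part_ge0; first by rewrite eqmx_opp.
  rewrite (_ : pos_part _ = set0) ?/excess ?big1 // => [i _|].
    by rewrite set0I cards0.
  by apply/setP => j; rewrite !inE mxE oppr_gt0 ltNge x0.
apply/rowP => j; apply/eqP; rewrite mxE eq_le x0 andbT.
by have := x0' j; rewrite mxE oppr_ge0.
Qed.

Variables (B : {set 'I_r}) (kk : 'I_r -> nat) (kB : nat).
Let nB := (\sum_(i in B) n i)%N.
Hypotheses (kB0 : B = set0 -> kB = 0%N)
  (le_k : (\sum_(i in ~: B) kk i + kB <= k)%N)
  (lt_n : (\sum_(i in ~: B) kk i + kB < \sum_i n i)%N).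

Lemma deleted_set : exists D : {set 'I_m},
  [/\ forall i, i \notin B -> (#|block blk i :\: D| <= 2 * kk i + 3)%N,
      (\sum_(i in B) (#|block blk i :\: D|).-1 <= 2 * kB + 1)%N &
      (#|D| <= \sum_(i in ~: B) (n i - (2 * kk i + 2)) + (nB - (2 * kB + 1)))%N].
Proof.
have /choice[DA hDA] : forall i, exists D : {set 'I_m}, D \subset block blk i /\
    #|D| = (n i - (2 * kk i + 2))%N.
  move=> i; have [D [h1 h2]] := take_subset (block blk i) (n i - (2 * kk i + 2)).
  exists D; split=> //; rewrite h2 card_block; apply/minn_idPl.
  exact: leq_trans (leq_subr _ _) _.
have /choice[rep hrep] : forall i, exists j, blk j = i.
  move=> i; have : (0 < #|block blk i|)%N by rewrite card_block.
  by rewrite card_gt0 => /set0Pn[j]; rewrite inE => /eqP; exists j.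
(* One element [rep i] of each block of [B] is protected, so that every deletion within [B] lowers
   the sum of the sizes minus one by exactly one. *)
pose E := [set j | (blk j \in B) && (j != rep (blk j))].
have blkE i : i \in B -> block blk i :&: E = block blk i :\ rep i.
  move=> iB; apply/setP => j; rewrite !inE.
  by case: eqVneq => [->|]; rewrite ?iB ?andbF //= andbT.
have cE : #|E| = nB.
  rewrite (_ : E = [set j in E | blk j \in B]); last first.
    by apply/setP => j; rewrite !inE andbAC andbb.
  rewrite card_blocks; apply: eq_bigr => i iB; rewrite setIC blkE //.
  have := cardsD1 (rep i) (block blk i); rewrite card_block inE hrep eqxx.
  by case.
have [DB [sDB cDB]] := take_subset E (nB - (2 * kB + 1)).
have {}cDB : #|DB| = (nB - (2 * kB + 1))%N.
  by rewrite cDB cE; apply/minn_idPl; exact: leq_subr.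
pose D := [set j | (blk j \notin B) && (j \in DA (blk j))] :|: DB.
exists D; split.
- move=> i iB; apply: (@leq_trans #|block blk i :\: DA i|).
    apply/subset_leq_card/subsetP => j; rewrite !inE negb_or => /andP[/andP[+ _] /eqP ji].
    by rewrite ji iB /= eqxx => ->.
  rewrite cardsD (setIidPr (hDA i).1) (hDA i).2 card_block.
  lia.
- suff : (\sum_(i in B) (#|block blk i :\: D|).-1 + #|DB| <= nB)%N by rewrite cDB; lia.
  rewrite (_ : DB = [set j in DB | blk j \in B]); last first.
    apply/setP => j; rewrite [RHS]inE; case jD: (j \in DB) => //=.
    by have := subsetP sDB _ jD; rewrite inE => /andP[->].
  rewrite card_blocks -big_split /=; apply: leq_sum => i iB.
  have h1 : (#|block blk i :\: D| <= #|block blk i :\: DB|)%N.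
    by apply/subset_leq_card/setDS/subsetUr.
  have h2 : (#|DB :&: block blk i| <= n i)%N.
    rewrite -ltnS -card_block (cardsD1 (rep i) (block blk i)) inE hrep eqxx add1n ltnS.
    apply/subset_leq_card/subsetP => j; rewrite !inE => /andP[jD /eqP ji].
    by have := subsetP sDB _ jD; rewrite !inE ji eqxx andbT => /andP[].
  move: h1; rewrite [X in (_ <= X)%N -> _]cardsD card_block [block _ _ :&: DB]setIC.
  move: h2; move: (n i) #|DB :&: block blk i| #|block blk i :\: D| => x y z. lia.
- apply: leq_trans (leq_card_setU _ _) _; rewrite cDB leq_add2r.
  rewrite (_ : [set j | _] = [set j in [set j | j \in DA (blk j)] | blk j \notin B]).
    rewrite (card_blocks blk (fun i => i \notin B)).
    rewrite [X in (_ <= X)%N](eq_bigl (fun i => i \notin B)) => [|i]; last by rewrite inE.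
    apply: leq_sum => i _; rewrite -(hDA i).2; apply/subset_leq_card/subsetP => j.
    by rewrite !inE => /andP[+ /eqP ji]; rewrite ji.
  by apply/setP => j; rewrite !inE andbC.
Qed.

(* One colour per deleted element, one per block outside [B] and one for [B]:
   by counting, two undeleted non-faces of the same colour must meet. *)
Lemma colour_bound :
  (\rank M + 1 <= \sum_(i in ~: B) (n i - (2 * kk i + 2)) + (nB - (2 * kB + 1))
     + #|~: B| + (B != set0))%N.
Proof.
have [D [hA hB cD]] := deleted_set.
pose C : finType := ({j | j \in D} + {i | i \in ~: B} + 'I_(B != set0))%type.
pose bad (c : C) (U : {set 'I_m}) := match c with
  | inl (inl j) => val j \in U
  | inl (inr i) => (kk (val i) + 2 <= #|U :&: (block blk (val i) :\: D)|)%N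
  | inr _ => (kB + 1 <= \sum_(i in B) (#|U :&: (block blk i :\: D)|).-1)%N
  end.
have meetD (U U' : {set 'I_m}) i : [disjoint U & U'] ->
    (#|U :&: (block blk i :\: D)| + #|U' :&: (block blk i :\: D)|
       <= #|block blk i :\: D|)%N.
  move=> d; set K := _ :\: D; rewrite -cardsUI.
  rewrite (_ : _ :&: (U' :&: K) = set0) ?cards0 ?addn0; last first.
    by rewrite setIACA (disjoint_setI0 d) set0I.
  by apply: subset_leq_card; rewrite subUset !subsetIr.
have bad_meet c U U' : bad c U -> bad c U' -> ~~ [disjoint U & U'].
  move=> b1 b2; apply/negP => d; case: c b1 b2 => [[[j jD]|[i iB]]|u] /=.
  - by move=> jU jU'; have := disjointFr d jU; rewrite jU'.
  - move: (iB) (meetD _ _ i d); rewrite inE => /hA.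
    move: #|block blk i :\: D| #|U :&: _| #|U' :&: _| (kk i) => x y z w; lia.
  (* For disjoint sets [a.-1 + b.-1 <= (a + b).-1] in each block, so two of them would need total
     excess [2 * kB + 2], one more than is left. *)
  - move=> b1 b2; have : (\sum_(i in B) (#|U :&: (block blk i :\: D)|).-1
       + \sum_(i in B) (#|U' :&: (block blk i :\: D)|).-1
       <= \sum_(i in B) (#|block blk i :\: D|).-1)%N.
      rewrite -big_split; apply: leq_sum => i _ /=; have := meetD _ _ i d.
      by move: #|block blk i :\: D| #|U :&: _| #|U' :&: _| => x y z; lia.
    by move: hB b1 b2; move: (\sum_(i in B) _)%N (\sum_(i in B) _)%N (\sum_(i in B) _)%N => x y z; lia.
have good U : (forall c, ~~ bad c U) ->
    (excess blk U <= \sum_(i in ~: B) kk i + kB)%N.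
  move=> nb.
  have UD : U :&: D = set0.
    apply/setP => j; rewrite !inE; apply/negP => /andP[jU jD].
    by have := nb (inl (inl (Sub j jD))); rewrite /= jU.
  have UK i : U :&: (block blk i :\: D) = U :&: block blk i.
    apply/setP => j; rewrite !inE; case jU: (j \in U) => //=.
    by have := in_set0 j; rewrite -UD inE jU /= => ->.
  rewrite /excess (bigID (mem (~: B))) /=; apply: leq_add.
    apply: leq_sum => i iB; have := nb (inl (inr (Sub i iB))); rewrite /= UK; lia.
  rewrite (eq_bigl (mem B)) => [|i]; last by rewrite inE negbK.
  have [->|B0] := eqVneq B set0; first by rewrite big_set0.
  have zlt : (0 < (B != set0))%N by rewrite B0.
  have := nb (inr (Ordinal zlt)); rewrite /=.
  by under eq_bigr => i _ do rewrite UK; rewrite -ltnNge addn1 ltnS.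
pose L := col_mx M (const_mx 1 : 'rV[R]_m).
have rL : (\rank M + 1 <= \rank L)%N.
  rewrite addn1; apply: rank_ltmx; rewrite ltmxE; apply/andP; split.
    by rewrite -addsmxE addsmxSl.
  rewrite -addsmxE addsmx_sub submx_refl /=; apply/negP => h.
  have : (- const_mx 1 : 'rV[R]_m) = 0.
    apply: small_pos_part_eq0; first by rewrite eqmx_opp.
    rewrite (_ : pos_part _ = set0) ?/excess ?big1 // => [i _|].
      by rewrite set0I cards0.
    by apply/setP => j; rewrite !inE !mxE oppr_gt0 ltNge ler01.
  have [i] : exists i : 'I_r, true.
    move: lt_n; case: (pickP 'I_r) => [i _|no]; first by exists i.
    by rewrite [X in (_ < X)%N]big_pred0.
  have : (0 < #|block blk i|)%N by rewrite card_block.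
  rewrite card_gt0 => /set0Pn[j _] _ /rowP/(_ j); rewrite !mxE => /eqP.
  by rewrite oppr_eq0 oner_eq0.
(* [Phi] consists of [m - \rank L] equations cutting out [L], so [linear_sarkaria] turns into a
   bound of [\rank L] by the number of colours. *)
apply: leq_trans rL _; pose Phi := col_base (cokermx L).
have rm : (\rank L <= m)%N by exact: rank_leq_col.
have cs (T : finType) (S : {set T}) : #|[pred x in S]| = #|S| by apply: eq_card.
suff /(linear_sarkaria bad_meet) : forall x : 'rV[R]_m, x != 0 -> x *m Phi = 0 ->
    exists c, bad c (pos_part x) || bad c (neg_part x).
  by rewrite mxrank_coker !card_sum !card_sig card_ord !cs; lia.
move=> x x0 xPhi; apply: contrapT => no.
have ep : (excess blk (pos_part x) <= \sum_(i in ~: B) kk i + kB)%N.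
  by apply: good => c; apply/negP => hc; apply: no; exists c; rewrite hc.
have en : (excess blk (neg_part x) <= \sum_(i in ~: B) kk i + kB)%N.
  by apply: good => c; apply/negP => hc; apply: no; exists c; rewrite hc orbT.
have xL : (x <= L)%MS.
  by rewrite submxE -(mulmx_base (cokermx L)) mulmxA xPhi mul0mx.
(* The coefficient [a] may be taken nonnegative: negation exchanges the two parts of [x], and both
   are small here. *)
suff key (y : 'rV[R]_m) (a : R) : (y <= M)%MS -> 0 <= a -> y + const_mx a != 0 ->
    ~ (excess blk (pos_part (y + const_mx a)) <= \sum_(i in ~: B) kk i + kB)%N.
  have /submxP[d ed] := xL; move: ed; rewrite -[d]hsubmxK mul_row_col.
  set y := lsubmx d *m M; rewrite [rsubmx d]mx11_scalar mul_scalar_mx.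
  set a := rsubmx d 0 0; rewrite scalemx_const mulr1 => ex.
  have yM : (y <= M)%MS by exact: submxMl.
  have [a0|a0] := leP 0 a; first by apply: (key y a) => //; rewrite -ex.
  have eNx : - x = - y + const_mx (- a) by rewrite ex opprD raddfN.
  apply: (key (- y) (- a)); rewrite ?eqmx_opp ?oppr_ge0 ?ltW // -eNx ?oppr_eq0 //.
  rewrite (_ : pos_part (- x) = neg_part x) //.
  by apply/setP => j; rewrite !inE mxE oppr_gt0.
move=> yM a0 nz e.
have y0 : y = 0.
  apply: small_pos_part_eq0 => //; apply: leq_trans le_k; apply: leq_trans e.
  apply: excess_sub; apply/subsetP => j; rewrite !inE !mxE => yj.
  exact: ltr_wpDr.
move: nz e; rewrite y0 add0r => nz; rewrite leqNgt => /negP; apply.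
apply: leq_trans lt_n _; rewrite /excess; apply: leq_sum => i _.
rewrite (_ : pos_part _ = setT) ?setTI ?card_block //.
apply/setP => j; rewrite !inE mxE lt_def a0 andbT.
by apply: contraNneq nz => ->; rewrite raddf0.
Qed.

End ColourBound.

(** * Boxes in a product of finite sets *)

Lemma imset_inj_surj (T : finType) (f : T -> T) (S : {set T}) : injective f ->
  (forall x, x \in S -> f x \in S) -> f @: S = S.
Proof.
move=> fi fS; apply/eqP; rewrite eqEcard card_imset // leqnn andbT.
by apply/subsetP => _ /imsetP[x xS ->]; apply: fS.
Qed.

Section Boxes.
Variables (m r : nat) (blk : 'I_m -> 'I_r) (P : finType) (elt : P -> 'I_r -> 'I_m).
Hypotheses (blk_elt : forall p i, blk (elt p i) = i)
  (elt_inj : forall p q, elt p =1 elt q -> p = q)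
  (elt_surj : forall f, (forall i, blk (f i) = i) -> exists p, elt p =1 f).

(** [P] stands for the vertices of the product, ['I_m] for the disjoint union of the vertices of the
    factors, and [elt p i] for the component of [p] in factor [i]. Boxes are then the vertex sets of
    faces. *)
Definition box (U : {set 'I_m}) : {set P} := [set p | [forall i, elt p i \in U]].
Definition coords (p : P) : {set 'I_m} := [set elt p i | i in 'I_r].
Definition is_box (F : {set P}) := [exists U, F == box U].

Lemma boxP (U : {set 'I_m}) p : reflect (forall i, elt p i \in U) (p \in box U).
Proof. by rewrite inE; apply: forallP. Qed.

Lemma mem_coords p j : (j \in coords p) = (elt p (blk j) == j).
Proof.
apply/imsetP/eqP => [[i _ ->]|<-]; first by rewrite blk_elt.
by exists (blk j).
Qed.

Lemma card_coords p : #|coords p| = r.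
Proof.
rewrite card_imset ?card_ord // => i i' /(congr1 blk).
by rewrite !blk_elt.
Qed.

Lemma box_coords (U : {set 'I_m}) p : (p \in box U) = (coords p \subset U).
Proof.
apply/boxP/subsetP => [h _ /imsetP[i _ ->]//|h i].
by apply: h; apply: imset_f.
Qed.

Lemma box1 p : box (coords p) = [set p].
Proof.
apply/setP => q; apply/boxP/set1P => [h|-> i]; last exact: imset_f.
by apply: elt_inj => i; have := h i; rewrite mem_coords blk_elt => /eqP.
Qed.

Lemma box_mono (U U' : {set 'I_m}) : U \subset U' -> box U \subset box U'.
Proof. by move=> UU'; apply/subsetP => p /boxP h; apply/boxP => i; apply: (subsetP UU'). Qed.

Definition move_to_spec p j q := forall i, elt q i = if i == blk j then j else elt p i.

Lemma move_to p j : exists q, move_to_spec p j q.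
Proof. by apply: elt_surj => i; case: eqP => [->|_]; rewrite ?blk_elt. Qed.

Lemma box_sub (U U' : {set 'I_m}) : box U != set0 -> (box U \subset box U') = (U \subset U').
Proof.
case/set0Pn => p /boxP pU; apply/idP/idP => [h|]; last exact: box_mono.
apply/subsetP => j jU; have [q hq] := move_to p j.
have /(subsetP h)/boxP/(_ (blk j)) : q \in box U.
  by apply/boxP => i; rewrite hq; case: eqP.
by rewrite hq eqxx.
Qed.

Lemma box_transversal (U : {set 'I_m}) :
  (box U != set0) <-> forall i, exists2 j, j \in U & blk j = i.
Proof.
split=> [/set0Pn[p /boxP pU] i|h]; first by exists (elt p i).
have /choice[f hf] : forall i, exists j, blk j = i /\ j \in U.
  by move=> i; have [j jU ji] := h i; exists j.
have [|p hp] := elt_surj (f := f); first by move=> i; case: (hf i).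
by apply/set0Pn; exists p; apply/boxP => i; rewrite hp; case: (hf i).
Qed.

Definition edges := [set E : {set P} | (#|E| == 2%N) && is_box E].
Definition edges_at p (F : {set P}) := [set E in edges | (p \in E) && (E \subset F)].

Lemma card_edge p j : j \notin coords p -> #|box (j |: coords p)| = 2%N.
Proof.
move=> jp; have [q hq] := move_to p j.
have pq : p != q.
  apply: contraNneq jp => e; rewrite mem_coords.
  by rewrite e hq eqxx.
rewrite (_ : box _ = [set p; q]) ?cards2 ?pq //; apply/setP => t; rewrite !inE.
apply/forallP/orP => [h|[/eqP->|/eqP->] i]; last 2 first.
- by rewrite !inE mem_coords blk_elt eqxx ?orbT.
- by rewrite hq !inE; case: (eqVneq i (blk j)) => [_|_]; rewrite ?eqxx // mem_coords blk_elt eqxx orbT.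
have hi i : elt t i = elt p i \/ (i = blk j /\ elt t i = j).
  have := h i; rewrite !inE => /orP[/eqP e|]; first by right; rewrite -{1}e blk_elt.
  by rewrite mem_coords blk_elt => /eqP; left.
have [e|[_ e]] := hi (blk j); [left|right]; apply/eqP/elt_inj => i.
  by have [//|[ei _]] := hi i; rewrite ei.
by rewrite hq; case: eqP => [->//|ne]; have [//|[]] := hi i.
Qed.

(* The number of edges at a vertex of a box is the dimension of the box. *)
Lemma card_edges_at (U : {set 'I_m}) p : p \in box U -> (#|edges_at p (box U)| + r = #|U|)%N.
Proof.
move=> pU; have cU : coords p \subset U by rewrite -box_coords.
rewrite -(card_coords p) -[RHS](cardsID (coords p) U) (setIidPr cU) addnC; congr (_ + _)%N.
have pj (W : {set 'I_m}) : p \in box (W :|: coords p) by rewrite box_coords subsetUr.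
rewrite -[RHS](card_in_imset (f := fun j => box (j |: coords p))) => [|j j']; last first.
  rewrite !inE => /andP[jp _] /andP[j'p _] e.
  have : box (j |: coords p) \subset box (j' |: coords p) by rewrite e.
  rewrite box_sub; last by apply/set0Pn; exists p; apply: pj.
  by rewrite subUset sub1set !inE (negbTE jp) orbF => /andP[/eqP].
apply: eq_card => E; apply/setIdP/imsetP => [[]|[j]].
  rewrite inE => /andP[/eqP cE /existsP[W /eqP eW]] /andP[pE EU].
  have [q qE qp] : exists2 q, q \in E & q != p.
    have : (0 < #|E :\ p|)%N by have := cardsD1 p E; rewrite cE pE add1n => -[<-].
    by rewrite card_gt0 => /set0Pn[q]; rewrite !inE => /andP[? ?]; exists q.
  have [i ne] : exists i, elt q i != elt p i.
    apply: contrapT => no; case/eqP: qp; apply: elt_inj => i.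
    by apply/eqP; apply/negPn/negP => h; apply: no; exists i.
  have jp : elt q i \notin coords p by rewrite mem_coords blk_elt eq_sym.
  exists (elt q i); first by rewrite inE jp; apply/boxP; apply: (subsetP EU).
  apply/esym/eqP; rewrite eqEcard card_edge // cE andbT eW; apply: box_mono.
  rewrite subUset sub1set -box_coords -eW pE andbT.
  by apply/boxP; rewrite -eW.
rewrite inE => /andP[jp jU] ->; split.
  by rewrite inE card_edge //=; apply/existsP; exists (j |: coords p).
by rewrite pj box_mono // subUset sub1set jU.
Qed.

Lemma edge_card_coords (U : {set 'I_m}) : box U \in edges -> #|U| = r.+1.
Proof.
move=> bE; have := bE; rewrite inE => /andP[/eqP c2 _].
have /set0Pn[p pU] : box U != set0 by rewrite -card_gt0 c2.
rewrite -(card_edges_at pU) -add1n; congr (_ + _)%N; apply/eqP/cards1P; exists (box U).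
apply/setP => E; rewrite [RHS]inE [LHS]inE; apply/andP/eqP => [[+ /andP[_ EU]]|->].
  rewrite inE => /andP[/eqP cE _]; apply/eqP; rewrite eqEcard EU cE c2 //.
by rewrite bE pU subxx.
Qed.

Variables (k : nat) (g : {set P} -> {set P}).
(** The nonempty faces of dimension at most [k], a nonempty [box U] having dimension [#|U| - r]. In
    the application [g] sends such a face to the preimage in [W] of the matching face of [V]. *)
Definition cell (F : {set P}) :=
  (F != set0) && [exists U, (F == box U) && (#|U| <= k + r)%N].
Hypotheses (g_box : forall F, cell F -> is_box (g F))
  (g_sub : forall F F', cell F -> cell F' -> (F \subset F') = (g F \subset g F'))
  (g_pt : forall p, g [set p] != set0)
  (g_ptI : forall p q, g [set p] :&: g [set q] != set0 -> p = q).

Lemma cell_box (U : {set 'I_m}) : box U != set0 -> (#|U| <= k + r)%N -> cell (box U).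
Proof. by move=> U0 cU; rewrite /cell U0; apply/existsP; exists U; rewrite eqxx. Qed.

Lemma cell1 p : cell [set p].
Proof.
rewrite -box1; apply: cell_box; last by rewrite card_coords leq_addl.
by rewrite box1; apply/set0Pn; exists p; rewrite inE.
Qed.

(** A choice of a point in each [g [set p]] is injective by [g_ptI], hence a permutation of the
    finite set [P]. So each [g [set p]] is a singleton, and monotonicity determines [g] on cells. *)
Lemma cell_image : exists s : P -> P, injective s /\ forall F, cell F -> g F = s @: F.
Proof.
have /choice[s hs] : forall p, exists q, q \in g [set p] by move=> p; apply/set0Pn.
have si : injective s.
  move=> p q e; apply: g_ptI; apply/set0Pn; exists (s p); rewrite inE hs e.
  exact: hs.
have ss q : exists p, q = s p by exists (invF si q); rewrite f_invF.
exists s; split=> // F cF; apply/setP => q; have [p ->] := ss q.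
rewrite mem_imset //.
have g1 : g [set p] = [set s p].
  apply/setP => t; rewrite inE; apply/idP/eqP => [|->//].
  have [p' ->] := ss t => h; congr s.
  by apply/esym/g_ptI/set0Pn; exists (s p'); rewrite inE h hs.
by rewrite -sub1set -g1 -g_sub ?cell1 // sub1set.
Qed.

(** It suffices that the permutation [s] maps cells to cells, an injective self-map of a finite set
    being onto. Images of cells are boxes, so only their dimension needs control. *)
Lemma cell_surjective (U : {set 'I_m}) : box U != set0 -> (#|U| <= k + r)%N ->
  exists F, cell F /\ g F = box U.
Proof.
move=> U0 cU; have [s [si sg]] := cell_image.
have imi : injective (fun F : {set P} => s @: F) by exact: imset_inj.
have card_box1 q (W : {set 'I_m}) : box W = [set q] -> #|W| = r.
  move=> e; rewrite -(card_coords q); congr #|pred_of_set _|; apply/eqP.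
  have qW : coords q \subset W by rewrite -box_coords e set11.
  rewrite eqEsubset qW andbT -box_sub ?e ?box1 //.
  by apply/set0Pn; exists q; rewrite set11.
have cellS F : cell F -> cell (s @: F).
  move=> cF; have := cF; case/andP => /set0Pn[p pF] /existsP[W /andP[/eqP eF cW]].
  have := g_box cF; rewrite sg // => /existsP[W' /eqP eW'].
  have sp : s p \in s @: F by apply: imset_f.
  rewrite eW'; apply: cell_box; first by rewrite -eW'; apply/set0Pn; exists (s p).
  have [k0|kpos] := posnP k.
    rewrite (@card_box1 (s p) W') ?leq_addl // -eW' (_ : F = [set p]) ?imset_set1 //.
    have pW : coords p \subset W by rewrite -box_coords -eF.
    rewrite eF -box1; congr box; apply/esym/eqP.
    by rewrite eqEcard pW card_coords; rewrite k0 in cW.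
  (* For [k > 0] edges are cells, so [s] permutes them. Every edge at [s p] inside the image then
     comes from an edge at [p] inside [F], and the vertex degree, which is the dimension, does not
     grow. *)
  have sE : (fun F : {set P} => s @: F) @: edges = edges.
    apply: imset_inj_surj => // E Ee; have := Ee; rewrite inE => /andP[/eqP c2 /existsP[X /eqP eX]].
    rewrite inE card_imset // c2 eqxx /= -sg ?g_box // eX; subst E.
      apply: cell_box; first by rewrite -card_gt0 c2.
      by rewrite edge_card_coords // -add1n leq_add2r.
    apply: cell_box; first by rewrite -card_gt0 c2.
    by rewrite edge_card_coords // -add1n leq_add2r.
  have pW : p \in box W by rewrite -eF.
  rewrite -(card_edges_at (p := s p)) -?eW' //.
  apply: leq_trans cW; rewrite -(card_edges_at pW) -eF leq_add2r.
  rewrite -(card_imset (edges_at p F) imi); apply/subset_leq_card/subsetP => E'.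
  rewrite inE => /and3P[]; rewrite -sE => /imsetP[E Ee ->] spE sub.
  apply: imset_f; rewrite inE Ee -(mem_imset _ _ si) spE /=.
  apply/subsetP => q qE; rewrite -(mem_imset _ _ si).
  by apply: (subsetP sub); apply: imset_f.
have /setP/(_ (box U)) : (fun F : {set P} => s @: F) @: [set F | cell F] = [set F | cell F].
  by apply: imset_inj_surj => // F; rewrite !inE; apply: cellS.
rewrite [in RHS]inE cell_box // => /imsetP[F]; rewrite inE => cF e.
by exists F; rewrite sg.
Qed.

End Boxes.

(** * Faces of the product of simplices *)

Lemma ps_choices_cons a n :
  ps_choices (a :: n) = [seq x :: s | x <- iota 0%N a.+1, s <- ps_choices n].
Proof. by []. Qed.

Lemma mem_ps_choices (n s : seq nat) : s \in ps_choices n <->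
  size s = size n /\ forall i, (i < size n)%N -> (nth 0%N s i < (nth 0%N n i).+1)%N.
Proof.
elim: n s => [|a n IH] s; first by case: s => [|b s]; split=> // -[].
rewrite ps_choices_cons.
split=> [/allpairsP[[x t] [xi /IH[st ht] ->]]|].
  change (is_true (x \in iota 0%N a.+1)) in xi.
  split=> [|[|i]]; [by rewrite /= st| |exact: ht].
  by move: xi; rewrite mem_iota add0n.
case: s => [|b s] [] // [ss] hs; apply/allpairsP; exists (b, s); split=> //.
  by rewrite -[_.1]/b mem_iota add0n; apply: (hs 0%N).
by apply/IH; split=> // i hi; apply: (hs i.+1).
Qed.

Lemma uniq_ps_choices n : uniq (ps_choices n).
Proof.
elim: n => // a n IH; rewrite ps_choices_cons; apply: allpairs_uniq => //; first exact: iota_uniq.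
by move=> [x s] [y t] _ _ /= [-> ->].
Qed.

Section ProdSimplex.
Variables (R : rcfType) (n : seq nat).
Let sh := [seq m.+1 | m <- n].
Let m := ps_dim n.
Let r := size n.
Notation V := (prod_simplex R n).

Lemma ps_blk_proof (j : 'I_m) : (reshape_index sh j < r)%N.
Proof. by have := reshape_indexP (ltn_ord j); rewrite size_map. Qed.

Definition ps_blk (j : 'I_m) : 'I_r := Ordinal (ps_blk_proof j).

Definition ps_choice (p : 'I_(size V)) : seq nat := nth [::] (ps_choices n) p.

Lemma ps_choice_lt p (i : 'I_r) : (nth 0%N (ps_choice p) i < nth 0%N sh i)%N.
Proof.
have : ps_choice p \in ps_choices n by rewrite mem_nth // -(size_map (ps_point R n)).
by case/mem_ps_choices => _ /(_ i (ltn_ord i)); rewrite (nth_map 0%N).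
Qed.

Lemma ps_elt_proof p (i : 'I_r) : (flatten_index sh i (nth 0%N (ps_choice p) i) < m)%N.
Proof. by apply: flatten_indexP; rewrite ?size_map ?ps_choice_lt. Qed.

Definition ps_elt p (i : 'I_r) : 'I_m := Ordinal (ps_elt_proof p i).

Lemma ps_blk_elt p i : ps_blk (ps_elt p i) = i.
Proof. by apply: val_inj; rewrite /= flatten_indexKl // ps_choice_lt. Qed.

Lemma ps_elt_inj p p' : ps_elt p =1 ps_elt p' -> p = p'.
Proof.
move=> e; apply: val_inj => /=.
have sz q : (q < size V)%N -> (q < size (ps_choices n))%N by rewrite size_map.
have szc q : size (ps_choice q) = r.
  by have /mem_ps_choices[] : ps_choice q \in ps_choices n by rewrite mem_nth // sz.
apply/eqP; rewrite -(nth_uniq [::] _ _ (uniq_ps_choices n)) ?sz //; apply/eqP.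
apply: (eq_from_nth (x0 := 0%N)) => [|i]; rewrite -?/(ps_choice _) ?szc // => hi.
have /(congr1 val) /(congr1 (reshape_offset sh)) /= := e (Ordinal hi).
by rewrite !flatten_indexKr //; apply: (ps_choice_lt _ (Ordinal hi)).
Qed.

Lemma ps_elt_surj (f : 'I_r -> 'I_m) : (forall i, ps_blk (f i) = i) ->
  exists p, ps_elt p =1 f.
Proof.
move=> hf; pose c := [seq reshape_offset sh (f i) | i <- enum 'I_r].
have nc (i : 'I_r) : nth 0%N c i = reshape_offset sh (f i).
  by rewrite (nth_map i) ?size_enum_ord // nth_ord_enum.
have hc : c \in ps_choices n.
  apply/mem_ps_choices; split; first by rewrite size_map size_enum_ord.
  move=> i hi; rewrite (nc (Ordinal hi)) -(nth_map _ 0%N S) //.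
  have := reshape_offsetP (ltn_ord (f (Ordinal hi))).
  by rewrite -/sh (_ : reshape_index sh _ = i) // -[RHS](congr1 val (hf (Ordinal hi))).
have hp : (index c (ps_choices n) < size V)%N by rewrite size_map index_mem.
exists (Ordinal hp) => i; apply: val_inj => /=.
rewrite /ps_choice /= nth_index // nc -{1}(hf i) /=; exact: reshape_indexK.
Qed.

Lemma ps_card_block i : #|block ps_blk i| = (nth 0%N n i).+1.
Proof.
have h (l : 'I_(nth 0%N sh i)) : (flatten_index sh i l < m)%N.
  by apply: flatten_indexP; rewrite ?size_map.
rewrite -(nth_map _ 0%N S) // -[RHS]card_ord -(card_imset (f := fun l => Ordinal (h l))).
  apply: eq_card => j; rewrite inE; apply/eqP/imsetP => [ji|[l _ ->]].
    have hl : (reshape_offset sh j < nth 0%N sh i)%N.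
      by rewrite -ji; exact: reshape_offsetP.
    exists (Ordinal hl) => //; apply: val_inj; rewrite /= -ji.
    by rewrite [RHS]reshape_indexK.
  by apply: val_inj; rewrite /= flatten_indexKl.
move=> l l' /(congr1 val) /(congr1 (reshape_offset sh)) /=.
by rewrite !flatten_indexKr // => /val_inj.
Qed.

Lemma ps_pointE (p : 'I_(size V)) (j : 'I_m) : V`_p 0 j = (j == ps_elt p (ps_blk j))%:R.
Proof.
rewrite (nth_map [::]) -?(size_map (ps_point R n)) // mxE -/(ps_choice p).
case: eqP => [e|ne].
  rewrite ifT //; apply/hasP; exists (ps_blk j : nat); first by rewrite mem_iota leq0n add0n ltn_ord.
  by apply/eqP; rewrite {1}e.
rewrite ifF //; apply/negP => /hasP[i]; rewrite mem_iota add0n => hi /eqP e.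
case: ne; have ej : j = ps_elt p (Ordinal hi) by apply: val_inj.
by rewrite {2}ej ps_blk_elt.
Qed.

Lemma ps_dotv (p : 'I_(size V)) u : dotv V`_p u = \sum_i u 0 (ps_elt p i).
Proof.
rewrite /dotv; under eq_bigr => j _ do rewrite ps_pointE.
rewrite (partition_big ps_blk predT) //=; apply: eq_bigr => i _.
rewrite (bigD1 (ps_elt p i)) ?ps_blk_elt //= eqxx mul1r big1 ?addr0 //.
by move=> j /andP[/eqP-> /negbTE->]; rewrite mul0r.
Qed.

Notation box := (box ps_elt).

(** A linear functional on a product is maximised factor by factor, so [U] collects the coordinates
    where it is maximal in their block. Conversely the indicator of [U] reaches the value [r]
    exactly on [box U]. The empty face is [box set0] because there is at least one factor. *)
Lemma ps_faceP (n0 : (0 < size n)%N) I : is_face V I <-> exists U, I = box U.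
Proof.
split=> [[u [b [ub hI]]]|[U ->]].
  have [->|/set0Pn[p0 p0I]] := eqVneq I set0.
    exists set0; apply/setP => p; rewrite inE; apply/esym/negbTE/boxP => /(_ (Ordinal n0)).
    by rewrite inE.
  exists [set j | u 0 (ps_elt p0 (ps_blk j)) <= u 0 j].
  have bE : b = \sum_i u 0 (ps_elt p0 i).
    by move: p0I; rewrite hI => /eqP <-; rewrite ps_dotv.
  have mx j : u 0 j <= u 0 (ps_elt p0 (ps_blk j)).
    have [|p hp] := ps_elt_surj (f := fun i => if i == ps_blk j then j else ps_elt p0 i).
      by move=> i; case: eqP => [->|_] //; rewrite ps_blk_elt.
    have := ub p; rewrite ps_dotv bE (bigD1 (ps_blk j)) //= [X in _ <= X](bigD1 (ps_blk j)) //=.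
    rewrite hp eqxx (eq_bigr (fun i => u 0 (ps_elt p0 i))) ?lerD2r // => i.
    by rewrite hp => /negbTE ->.
  apply/setP => p; rewrite hI ps_dotv bE; apply/eqP/boxP => [e i|h].
    rewrite inE ps_blk_elt.
    have := mx (ps_elt p i); rewrite le_eqVlt ps_blk_elt => /orP[/eqP->//|lt].
    suff : \sum_i u 0 (ps_elt p i) < \sum_i u 0 (ps_elt p0 i) by rewrite e ltxx.
    rewrite (bigD1 i) //= [X in _ < X](bigD1 i) //=; apply: ltr_leD => //.
    by apply: ler_sum => l _; have := mx (ps_elt p l); rewrite ps_blk_elt.
  apply: eq_bigr => i _; apply/eqP; rewrite eq_le.
  have := mx (ps_elt p i); rewrite ps_blk_elt => -> /=.
  by have := h i; rewrite inE ps_blk_elt.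
have rE : r%:R = \sum_(i < r) 1 :> R by rewrite sumr_const card_ord.
exists (\row_j (j \in U)%:R), r%:R; split=> p; rewrite ps_dotv.
  rewrite rE; apply: ler_sum => i _.
  by rewrite mxE; case: (_ \in U).
rewrite rE; apply/boxP/eqP => [h|h i].
  by apply: eq_bigr => i _; rewrite mxE h.
apply: contraPT h => nU; apply/eqP; rewrite lt_eqF //.
rewrite (bigD1 i) //= [X in _ < X](bigD1 i) //= mxE (negbTE nU); apply: ltr_leD => //.
by apply: ler_sum => l _; rewrite mxE; case: (_ \in U).
Qed.

Lemma ps_point_delta (p : 'I_(size V)) : V`_p = \sum_i delta_mx 0 (ps_elt p i).
Proof.
apply/rowP => j; rewrite ps_pointE summxE (bigD1 (ps_blk j)) //= big1 => [|i ij].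
  by rewrite mxE eqxx addr0.
rewrite mxE eqxx /=; case: eqP => // e.
by rewrite e ps_blk_elt eqxx in ij.
Qed.

Lemma ps_elt_injective p : injective (ps_elt p).
Proof. by move=> i i' /(congr1 ps_blk); rewrite !ps_blk_elt. Qed.

(** Differences from the base vertex [p0] are sums of the [#|U| - r] vectors [v j] with [j] in [U]
    and not a coordinate of [p0]. *)
Lemma fdim_box U : box U != set0 -> fdim V (box U) + r%:Z <= #|U|%:Z.
Proof.
case/set0Pn => q qU; rewrite /fdim; case: pickP => [p0 p0U|/(_ q)]; last by rewrite qU.
set D := \matrix_(_ < _) _; pose T0 := [set ps_elt p0 i | i in 'I_r].
have cT0 : #|T0| = r by rewrite card_imset ?card_ord //; exact: ps_elt_injective.
have T0U : T0 \subset U by rewrite -box_coords.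
have cS : (#|U :\: T0| + r = #|U|)%N.
  by rewrite -cT0 addnC -(cardsID T0 U) (setIidPr T0U).
pose v j : 'rV[R]_m := delta_mx 0 j - delta_mx 0 (ps_elt p0 (ps_blk j)).
pose G := \matrix_(l < #|U :\: T0|) v (enum_val l).
suff DG : (D <= G)%MS.
  rewrite -cS PoszD lerD2r lez_nat; apply: leq_trans (mxrankS DG) (rank_leq_row _).
apply/row_subP => p; rewrite rowK; case: ifP => [/boxP pU|_]; last exact: sub0mx.
rewrite !ps_point_delta -sumrB; apply: summx_sub => i _.
have [e|ne] := eqVneq (ps_elt p i) (ps_elt p0 i); first by rewrite e subrr sub0mx.
have hj : ps_elt p i \in U :\: T0.
  rewrite inE pU andbT; apply/imsetP => -[i' _ e].
  by have /(congr1 ps_blk) := e; rewrite !ps_blk_elt => ei; rewrite e ei eqxx in ne.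
suff -> : delta_mx 0 (ps_elt p i) - delta_mx 0 (ps_elt p0 i) = row (enum_rank_in hj (ps_elt p i)) G.
  exact: row_sub.
by rewrite rowK enum_rankK_in // /v ps_blk_elt.
Qed.

End ProdSimplex.

(** * Faces and supporting hyperplanes *)

Section Polytopes.
Variables (R : rcfType) (d : nat).
Implicit Types (V : seq 'rV[R]_d) (x c : 'rV[R]_d).

Lemma dotvE x c : dotv x c = (x *m c^T) 0 0.
Proof. by rewrite mxE; apply: eq_bigr => j _; rewrite mxE. Qed.

Lemma dotv_sum (I : finType) (w : I -> R) (v : I -> 'rV[R]_d) c :
  dotv (\sum_i w i *: v i) c = \sum_i w i * dotv (v i) c.
Proof.
rewrite dotvE mulmx_suml summxE; apply: eq_bigr => i _.
by rewrite -scalemxAl mxE dotvE.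
Qed.

Lemma dotvDr x c c' : dotv x (c + c') = dotv x c + dotv x c'.
Proof. by rewrite !dotvE raddfD mulmxDr mxE. Qed.

Lemma dotvZr x a c : dotv x (a *: c) = a * dotv x c.
Proof. by rewrite !dotvE linearZ -scalemxAr mxE. Qed.

Lemma dotv0r x : dotv x 0 = 0.
Proof. by rewrite dotvE raddf0 mulmx0 mxE. Qed.

Lemma in_conv_nth V (i : 'I_(size V)) : in_conv V V`_i.
Proof.
exists (fun j => (j == i)%:R); split=> [j||]; first exact: ler0n.
  by rewrite (bigD1 i) //= eqxx big1 ?addr0 // => j /negbTE->.
by rewrite (bigD1 i) //= eqxx scale1r big1 ?addr0 // => j /negbTE->; rewrite scale0r.
Qed.

Lemma in_conv_le V x c b : in_conv V x -> (forall i : 'I_(size V), dotv V`_i c <= b) ->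
  dotv x c <= b.
Proof.
case=> w [w0 w1 ->] h; rewrite dotv_sum -[b]mul1r -w1 mulr_suml.
by apply: ler_sum => i _; apply: ler_wpM2l.
Qed.

(* [i0] is any point of positive weight in a convex combination giving [x]. *)
Lemma in_conv_tight V x c b : in_conv V x ->
    (forall i : 'I_(size V), dotv V`_i c <= b) -> dotv x c = b ->
  exists i0, dotv V`_(i0 : 'I_(size V)) c = b /\
    forall c' b', (forall i : 'I_(size V), dotv V`_i c' <= b') ->
      (dotv x c' = b' -> dotv V`_i0 c' = b') /\
      ((forall i : 'I_(size V), dotv V`_i c = b -> dotv V`_i c' = b') -> dotv x c' = b').
Proof.
case=> w [w0 w1 xE].
have tight c' b' : (forall i : 'I_(size V), dotv V`_i c' <= b') -> dotv x c' = b' ->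
    forall i, 0 < w i -> dotv V`_i c' = b'.
  move=> h e i wi; apply/eqP; rewrite eq_le h leNgt; apply/negP => lt.
  suff : dotv x c' < b' by rewrite e ltxx.
  rewrite xE dotv_sum -[b']mul1r -w1 mulr_suml (bigD1 i) //= [X in _ < X](bigD1 i) //=.
  apply: ltr_leD; first by rewrite ltr_pM2l.
  by apply: ler_sum => l _; apply: ler_wpM2l.
move=> h e; have [i0 wi0] : exists i, 0 < w i.
  apply: contrapT => no; have /eqP := w1; rewrite big1 ?(eq_sym 0) ?oner_eq0 // => i _.
  apply/eqP; rewrite eq_le w0 leNgt andbT; apply/negP => wi; apply: no; by exists i.
exists i0; split=> [|c' b' h']; first exact: (tight _ _ h e).
split=> [e'|all]; first exact: (tight _ _ h' e').
rewrite xE dotv_sum -[b']mul1r -w1 mulr_suml; apply: eq_bigr => i _.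
have [wi|] := ltP 0 (w i); first by rewrite all //; apply: (tight _ _ h e).
move=> wi; have -> : w i = 0 by apply/eqP; rewrite eq_le wi w0.
by rewrite !mul0r.
Qed.

Lemma is_face0 V : is_face V set0.
Proof. by exists 0, 1; split=> i; rewrite dotv0r ?ler01 // inE eq_sym oner_eq0. Qed.

Lemma is_faceT V : is_face V setT.
Proof. by exists 0, 0; split=> i; rewrite dotv0r ?lexx // inE eqxx. Qed.

Lemma is_faceI V I J : is_face V I -> is_face V J -> is_face V (I :&: J).
Proof.
move=> [c [b [h hI]]] [c' [b' [h' hJ]]]; exists (c + c'), (b + b'); split=> i.
  by rewrite dotvDr lerD.
rewrite inE hI hJ dotvDr; apply/andP/eqP => [[/eqP-> /eqP->] //|e].
move: (h i) (h' i); rewrite le_eqVlt => /orP[/eqP e1|lt] le2.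
  by split; apply/eqP => //; apply: (addrI b); rewrite -[in LHS]e1.
by have := ltr_leD lt le2; rewrite e ltxx.
Qed.

Lemma fdimS V (I J : {set 'I_(size V)}) : I \subset J -> fdim V I <= fdim V J.
Proof.
move=> IJ; rewrite /fdim; case: pickP => [i iI|_]; last by case: pickP.
case: pickP => [j jJ|/(_ i)]; last by rewrite (subsetP IJ).
rewrite lez_nat; apply: mxrankS; set D := (X in (_ <= X)%MS).
have inD l : l \in J -> (V`_l - V`_j <= D)%MS.
  by move=> lJ; have := row_sub l D; rewrite rowK lJ.
apply/row_subP => l; rewrite rowK; case: ifP => [lI|_]; last exact: sub0mx.
have -> : V`_l - V`_i = (V`_l - V`_j) - (V`_i - V`_j) by rewrite opprB subrKA.
by rewrite addmx_sub ?eqmx_opp ?inD ?(subsetP IJ).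
Qed.

End Polytopes.

Lemma dotv_mulmx (R : rcfType) (d e : nat) (y : 'rV[R]_e) (A : 'M_(e, d)) c :
  dotv (y *m A) c = dotv y (c *m A^T).
Proof. by rewrite !dotvE trmx_mul trmxK mulmxA. Qed.

(** * Strictly preserved faces *)

Lemma fdim0 (R : rcfType) (d : nat) (V : seq 'rV[R]_d) : fdim V set0 = -1.
Proof. by rewrite /fdim; case: pickP => // i; rewrite inE. Qed.

Lemma iso_eq0 (ok : int -> bool) (R : rcfType) (d e : nat) (V : seq 'rV[R]_d)
    (W : seq 'rV[R]_e) (f : {set 'I_(size V)} -> {set 'I_(size W)}) : ok (-1) ->
    (forall I I', is_face V I -> ok (fdim V I) -> is_face V I' -> ok (fdim V I') ->
      (I \subset I') = (f I \subset f I')) ->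
  forall I, is_face V I -> ok (fdim V I) -> f I = set0 -> I = set0.
Proof.
move=> ok1 f_sub I fI okI e0; apply/eqP; rewrite -subset0 f_sub ?e0 ?sub0set //.
  exact: is_face0.
by rewrite fdim0.
Qed.

Section Projection.
Variables (R : rcfType) (k : nat) (n : seq nat) (d e : nat).
Variables (V : seq 'rV[R]_d) (W : seq 'rV[R]_e) (pi : 'M[R]_(e, d)).
Hypothesis n0 : (0 < size n)%N.
Notation Delta := (prod_simplex R n).
Notation ok := (fun a : int => a <= k%:Z).
Variables (fV : {set 'I_(size V)} -> {set 'I_(size Delta)})
  (fW : {set 'I_(size W)} -> {set 'I_(size Delta)}).
Hypotheses
  (fV_surj : forall J, is_face Delta J -> ok (fdim Delta J) ->
     exists I, [/\ is_face V I, ok (fdim V I) & fV I = J])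
  (fV_sub : forall I I', is_face V I -> ok (fdim V I) -> is_face V I' -> ok (fdim V I') ->
     (I \subset I') = (fV I \subset fV I'))
  (fW_face : forall I, is_face W I -> is_face Delta (fW I))
  (fW_surj : forall J, is_face Delta J -> exists I, is_face W I /\ fW I = J)
  (fW_sub : forall I I', is_face W I -> is_face W I' ->
     (I \subset I') = (fW I \subset fW I'))
  (convVW : forall x, in_conv V x <-> in_conv [seq w *m pi | w <- W] x).
Notation box := (box (@ps_elt R n)).

Definition valid (c : 'rV[R]_d) (b : R) := forall i : 'I_(size V), dotv V`_i c <= b.
(** For a valid inequality this is the preimage under [pi] of the face of [V] that it supports. *)
Definition tight_set (c : 'rV[R]_d) (b : R) : {set 'I_(size W)} :=
  [set i | dotv (W`_(i : 'I_(size W)) *m pi) c == b].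

Lemma proj_in_conv (i : 'I_(size W)) : in_conv V (W`_i *m pi).
Proof.
apply/convVW; have hi : (i < size [seq w *m pi | w <- W])%N by rewrite size_map.
by have := in_conv_nth (Ordinal hi); rewrite /= (nth_map 0).
Qed.

Lemma valid_proj c b : valid c b -> forall i : 'I_(size W), dotv (W`_i *m pi) c <= b.
Proof. by move=> h i; apply: (in_conv_le (proj_in_conv i)). Qed.

Lemma valid_seq c b : valid c b ->
  forall i : 'I_(size [seq w *m pi | w <- W]), dotv [seq w *m pi | w <- W]`_i c <= b.
Proof.
move=> h [i /= hi]; have hi' : (i < size W)%N by move: (hi); rewrite size_map.
by rewrite (nth_map 0) //; have := valid_proj h (Ordinal hi').
Qed.

Lemma tight_face c b : valid c b -> is_face W (tight_set c b).
Proof.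
move=> h; exists (c *m pi^T), b; split=> i; rewrite -dotv_mulmx; first exact: valid_proj.
by rewrite inE.
Qed.

(* Every point of a polytope on a supporting hyperplane is carried by vertices
   on it, so the faces of [V] and their preimages in [W] determine each other. *)
Lemma tight_meet c b c' b' w : valid c b -> valid c' b' ->
    w \in tight_set c b -> w \in tight_set c' b' ->
  exists v : 'I_(size V), dotv V`_v c = b /\ dotv V`_v c' = b'.
Proof.
move=> h h'; rewrite !inE => /eqP t /eqP t'.
have [v [tv /(_ _ _ h')[tv' _]]] := in_conv_tight (proj_in_conv w) h t.
by exists v; split=> //; apply: tv'.
Qed.

Lemma tight_lift c b (v : 'I_(size V)) : valid c b -> dotv V`_v c = b ->
  exists w : 'I_(size W), w \in tight_set c b /\
    forall c' b', valid c' b' ->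
      (dotv V`_v c' = b' -> w \in tight_set c' b') /\
      (tight_set c b \subset tight_set c' b' -> dotv V`_v c' = b').
Proof.
move=> h t; have vW := (convVW V`_v).1 (in_conv_nth v).
have [[w hw] [tw H]] := in_conv_tight vW (valid_seq h) t.
have hw' : (w < size W)%N by move: (hw); rewrite size_map.
move: tw; rewrite /= (nth_map 0) // => tw.
exists (Ordinal hw'); split; first by rewrite inE /= tw.
move=> c' b' h'; have [H1 H2] := H _ _ (valid_seq h').
split=> [/H1|sub]; first by rewrite /= (nth_map 0) // inE => ->.
apply: H2 => -[u hu]; have hu' : (u < size W)%N by move: (hu); rewrite size_map.
rewrite /= (nth_map 0) // => tu; apply/eqP.
have := subsetP sub (Ordinal hu'); rewrite !inE /= tu; exact.
Qed.

Lemma tight_sub c b c' b' : valid c b -> valid c' b' ->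
  (forall v : 'I_(size V), dotv V`_v c = b -> dotv V`_v c' = b') <->
  tight_set c b \subset tight_set c' b'.
Proof.
move=> h h'; split=> [sub|sub v t].
  apply/subsetP => w; rewrite !inE => /eqP t; apply/eqP.
  have [v [_ /(_ _ _ h')[_ H]]] := in_conv_tight (proj_in_conv w) h t.
  exact: H.
by have [w [_ /(_ _ _ h')[_]]] := tight_lift h t; apply.
Qed.

(* [V] and [W] have as many vertices as [Delta], so the map sending a face of [V]
   to its preimage in [W] permutes the vertices of [Delta]; [cell_surjective]
   does the rest. *)
Lemma preserved_face (U : {set 'I_(ps_dim n)}) : box U != set0 ->
    (#|U| <= k + size n)%N ->
  exists c b, valid c b /\ fW (tight_set c b) = box U.
Proof.
move=> U0 cU; pose cl := cell (@ps_elt R n) k.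
have cell_face F : cl F -> is_face Delta F /\ ok (fdim Delta F).
  case/andP => F0 /existsP[X /andP[/eqP eF cX]]; split; first by apply/ps_faceP => //; exists X.
  have := fdim_box (U := X) (R := R); rewrite -eF => /(_ F0); lia.
have /choice[cb hcb] : forall F, exists cb : 'rV[R]_d * R, cl F ->
    valid cb.1 cb.2 /\ exists I, [/\ is_face V I, ok (fdim V I), fV I = F &
       forall i : 'I_(size V), (i \in I) = (dotv V`_i cb.1 == cb.2)].
  move=> F; have [cF|nF] := boolP (cl F); last by exists (0, 0).
  have [h1 h2] := cell_face _ cF; have [I [fI oI eI]] := fV_surj h1 h2.
  have [c [b [hv hI]]] := fI; exists (c, b) => _; split=> //.
  by exists I.
pose th F := tight_set (cb F).1 (cb F).2.
have th_face F : cl F -> is_face W (th F) by case/hcb => h _; apply: tight_face.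
have W0 I : is_face W I -> fW I = set0 -> I = set0.
  by move=> fI eI; apply/eqP; rewrite -subset0 fW_sub ?eI ?sub0set //; exact: is_face0.
have V0 := iso_eq0 (ok := ok) isT fV_sub.
have fV0 : fV set0 = set0.
  have [|I [fI oI eI]] := fV_surj (is_face0 Delta); first by rewrite fdim0.
  by rewrite -[RHS]eI (V0 _ fI oI eI).
have fW0 : fW set0 = set0.
  by have [I [fI eI]] := fW_surj (is_face0 Delta); rewrite -[RHS]eI (W0 _ fI eI).
have c1 p : cl [set p].
  by apply: (cell1 (blk := @ps_blk n)); [exact: ps_blk_elt | exact: ps_elt_inj].
suff [F [cF eF]] : exists F, cl F /\ (fun F => fW (th F)) F = box U.
  by exists (cb F).1, (cb F).2; split=> //; case: (hcb F cF).
apply: (cell_surjective (blk := @ps_blk n)) => //.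
- exact: ps_blk_elt.
- exact: ps_elt_inj.
- exact: ps_elt_surj.
- move=> F cF; have := fW_face (th_face _ cF).
  by move/(ps_faceP n0) => [X ->]; apply/existsP; exists X.
- move=> F F' cF cF'; rewrite -fW_sub; [|exact: th_face..].
  have [h [I [fI oI eI hI]]] := hcb _ cF; have [h' [I' [fI' oI' eI' hI']]] := hcb _ cF'.
  have -> : (F \subset F') = (I \subset I') by rewrite fV_sub // eI eI'.
  apply/subsetP/idP => [sub|].
    by apply/(tight_sub h h') => v /eqP t; apply/eqP; rewrite -hI' sub // hI.
  by move/(tight_sub h h') => H v; rewrite hI hI' => /eqP t; apply/eqP/H.
- move=> p; have [h [I [fI oI eI hI]]] := hcb _ (c1 p); apply/eqP => /(W0 _ (th_face _ (c1 p))) eth.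
  have /set0Pn[v] : I != set0.
    by apply/eqP => I0; have := set11 p; rewrite -eI I0 fV0 inE.
  rewrite hI => /eqP t; have [w [wt _]] := tight_lift h t.
  by have := in_set0 w; rewrite -eth wt.
(* If the images of [p] and [q] shared a vertex [t], the face of [W] over [t] would lie in both
   preimages, and by [tight_meet] a vertex of [V] would lie in [I :&: I']. But [fV] sends this face
   below both [[set p]] and [[set q]], so it is empty. *)
- move=> p q /set0Pn[t]; rewrite inE => /andP[tp tq]; apply/eqP/negPn/negP => pq.
  have [h [I [fI oI eI hI]]] := hcb _ (c1 p).
  have [h' [I' [fI' oI' eI' hI']]] := hcb _ (c1 q).
  have II0 : I :&: I' = set0.
    have fII := is_faceI fI fI'.
    have oII : ok (fdim V (I :&: I')) := le_trans (fdimS (subsetIl I I')) oI.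
    apply: V0 => //; apply/eqP; rewrite -subset0; apply/subsetP => u uII.
    have hp : u \in [set p] by rewrite -eI; apply: subsetP uII; rewrite -fV_sub ?subsetIl.
    have hq : u \in [set q] by rewrite -eI'; apply: subsetP uII; rewrite -fV_sub ?subsetIr.
    by move: hp hq; rewrite !inE => /eqP -> /eqP pq'; rewrite pq' eqxx in pq.
  have [J [fJ eJ]] := fW_surj (cell_face _ (c1 t)).1.
  have /set0Pn[w wJ] : J != set0.
    by apply/eqP => J0; have := set11 t; rewrite -eJ J0 fW0 inE.
  have Jp : J \subset th [set p] by rewrite fW_sub ?eJ ?sub1set //; exact: th_face.
  have Jq : J \subset th [set q] by rewrite fW_sub ?eJ ?sub1set //; exact: th_face.
  have [v [tv tv']] := tight_meet h h' (subsetP Jp _ wJ) (subsetP Jq _ wJ).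
  by have := in_set0 v; rewrite -II0 inE hI hI' tv tv' !eqxx.
Qed.

End Projection.

(** * The Gale dual of the projection *)

(* Subtracting the largest admissible multiple of a facet functional enlarges
   the zero set, so the process ends with the zero functional. *)
Lemma facet_decomposition (R : rcfType) (Q J : finType) (s : J -> Q -> R)
    (aff : (Q -> R) -> Prop) :
  (forall j w, 0 <= s j w) ->
  (forall f j t, aff f -> aff (fun w => f w - t * s j w)) ->
  (forall f, aff f -> (forall w, 0 <= f w) -> (exists w, f w != 0) ->
     exists j, (exists w, s j w != 0) /\ forall w, f w = 0 -> s j w = 0) ->
  forall f, aff f -> (forall w, 0 <= f w) ->
    exists mu : J -> R, (forall j, 0 <= mu j) /\ forall w, f w = \sum_j mu j * s j w.
Proof.
move=> s0 affB facet f.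
move: {2}_.+1 (ltnSn #|[pred w | f w != 0]|) => N.
elim: N f => // N IH f; rewrite ltnS => leN af f0.
have [[w0 w0f]|no] := pselect (exists w, f w != 0); last first.
  exists (fun=> 0); split=> // w; rewrite big1 => [|j _]; last by rewrite mul0r.
  by apply/eqP/negPn/negP => h; apply: no; exists w.
have [|j [[w1 w1s] js]] := facet f af f0; first by exists w0.
pose t w := f w / s j w.
case: (arg_minP (P := fun w => s j w != 0) t w1s) => w2 w2s w2min.
have t0 : 0 <= t w2 by rewrite divr_ge0.
have [|w|mu [mu0 muE]] := IH (fun w => f w - t w2 * s j w) _ (affB f j (t w2) af).
- apply: leq_trans leN; apply: proper_card; apply/properP; split.
    apply/subsetP => w; rewrite !inE; apply: contraNneq => fw.
    by rewrite fw (js w fw) mulr0 subrr.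
  exists w2; rewrite !inE; first by apply: contraNneq w2s => /js ->.
  by rewrite /t divfK // subrr eqxx.
- rewrite subr_ge0; have [->|sw] := eqVneq (s j w) 0; first by rewrite mulr0.
  by rewrite -ler_pdivlMr ?w2min // lt_def sw s0.
exists (fun l => mu l + (if l == j then t w2 else 0)); split=> [l|w].
  by apply: addr_ge0 => //; case: eqP.
have /= fE := muE w; rewrite -[LHS](subrK (t w2 * s j w)) fE.
under [RHS]eq_bigr => l _ do rewrite mulrDl.
rewrite big_split /=; congr (_ + _); rewrite (bigD1 j) //= eqxx big1 ?addr0 // => l /negbTE->.
by rewrite mul0r.
Qed.

Lemma small_multiple (R : rcfType) (Q : finType) (f g : Q -> R) :
  (forall w, 0 <= f w) -> (forall w, 0 <= g w) -> (forall w, f w = 0 -> g w = 0) ->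
  exists eps, 0 < eps /\ forall w, eps * g w <= f w.
Proof.
(* Division by zero gives 0, so points with [f w = 0] add nothing to [S]. Every other quotient
   [g w / f w] is at most [S], and adding 1 keeps the inverse positive when [S = 0]. *)
move=> f0 g0 fg; pose S := \sum_w g w / f w.
have S0 : 0 <= S by apply: sumr_ge0 => w _; rewrite divr_ge0.
have S1 : 0 < 1 + S by rewrite ltr_pwDl.
exists (1 + S)^-1; split=> [|w]; first by rewrite invr_gt0.
rewrite mulrC ler_pdivrMr //.
have [fw|fw] := eqVneq (f w) 0; first by rewrite fw fg // mul0r.
have fp : 0 < f w by rewrite lt_def fw f0.
rewrite mulrC -ler_pdivrMr //; apply: (@le_trans _ _ S); last by rewrite lerDr.
rewrite /S (bigD1 w) //= lerDl; apply: sumr_ge0 => u _.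
by rewrite divr_ge0.
Qed.

Section Gale.
Variables (R : rcfType) (n : seq nat) (d e : nat).
Variables (W : seq 'rV[R]_e) (pi : 'M[R]_(e, d)).
Hypothesis n0 : (0 < size n)%N.
Notation Delta := (prod_simplex R n).
Notation m := (ps_dim n).
Notation box := (box (@ps_elt R n)).
Variable (fW : {set 'I_(size W)} -> {set 'I_(size Delta)}).
Hypotheses
  (fW_face : forall I, is_face W I -> is_face Delta (fW I))
  (fW_surj : forall J, is_face Delta J -> exists I, is_face W I /\ fW I = J)
  (fW_sub : forall I I', is_face W I -> is_face W I' ->
     (I \subset I') = (fW I \subset fW I')).

Variables (cf : 'I_m -> 'rV[R]_e) (bf : 'I_m -> R).
Definition slack j (w : 'I_(size W)) := bf j - dotv W`_w (cf j).
Definition facet j : {set 'I_(size W)} := [set w | slack j w == 0].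
Hypotheses (slack_ge0 : forall j w, 0 <= slack j w)
  (fW_facet : forall j, fW (facet j) = box [set~ j]).

Definition affine_on (f : 'I_(size W) -> R) := exists c b, forall w, f w = b - dotv W`_w c.

Lemma affine_face f : affine_on f -> (forall w, 0 <= f w) -> is_face W [set w | f w == 0].
Proof.
move=> [c [b fE]] f0; exists c, b; split=> w; first by have := f0 w; rewrite fE subr_ge0.
by rewrite inE fE subr_eq0 eq_sym.
Qed.

Lemma facet_face j : is_face W (facet j).
Proof. by apply: affine_face => //; exists (cf j), (bf j). Qed.

Lemma fWT : fW setT = setT.
Proof.
have [I [fI eI]] := fW_surj (is_faceT Delta).
apply/eqP; rewrite -subTset -eI -fW_sub ?subsetT //; exact: is_faceT.
Qed.

Lemma fW_inj0 I : is_face W I -> fW I = set0 -> I = set0.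
Proof.
by move=> fI eI; apply/eqP; rewrite -subset0 fW_sub ?eI ?sub0set //; exact: is_face0.
Qed.

Lemma fW0 : fW set0 = set0.
Proof. by have [I [fI eI]] := fW_surj (is_face0 Delta); rewrite -[RHS]eI (fW_inj0 fI eI). Qed.

Lemma slack_affine f : affine_on f -> (forall w, 0 <= f w) ->
  exists mu : 'I_m -> R, (forall j, 0 <= mu j) /\ forall w, f w = \sum_j mu j * slack j w.
Proof.
apply: facet_decomposition => [|{}f j t [c [b fE]]|{}f af f0 [w0 w0f]].
- exact: slack_ge0.
- exists (c - t *: cf j), (b - t * bf j) => w.
  by rewrite fE /slack dotvDr -scaleNr dotvZr; ring.
have fZ := affine_face af f0; have /(ps_faceP n0)[U eU] := fW_face fZ.
have [p pU] : exists p, p \notin box U.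
  apply: contrapT => no; case/eqP: w0f; apply/eqP.
  have : setT \subset [set w | f w == 0].
    rewrite fW_sub ?fWT; [|exact: is_faceT|exact: fZ].
    rewrite eU; apply/subsetP => p _; apply/negPn/negP => h; apply: no; by exists p.
  by move/subsetP/(_ w0 (in_setT w0)); rewrite inE.
(* Such a [j] gives a facet through the zero face of [f]; it is proper, since [box [set~ j]] misses
   every vertex with coordinate [j]. *)
have [j jU] : exists j, j \notin U.
  move: pU; rewrite inE negb_forall => /existsP[i]; by exists (ps_elt p i).
exists j; split; last first.
  move=> w fw; have : [set w | f w == 0] \subset facet j.
    rewrite fW_sub ?fW_facet ?eU //; last exact: facet_face.
    by apply: box_mono; rewrite subsetC sub1set inE.
  by move/subsetP/(_ w); rewrite !inE fw eqxx => /(_ isT)/eqP.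
apply: contrapT => no.
have : setT \subset facet j.
  apply/subsetP => w _; rewrite inE; apply/negPn/negP => h; apply: no; by exists w.
rewrite fW_sub ?fWT ?fW_facet; [|exact: is_faceT|exact: facet_face].
have [q hq] := move_to (blk := @ps_blk n) (@ps_blk_elt R n) (@ps_elt_surj R n) p j.
move/subsetP/(_ q (in_setT q))/boxP/(_ (ps_blk j)); rewrite hq eqxx !inE eqxx.
by [].
Qed.

(* Setting aside a small multiple of all the relevant slacks before decomposing
   makes every coefficient positive. *)
Lemma slack_positive (U : {set 'I_m}) f : affine_on f -> (forall w, 0 <= f w) ->
    box U != set0 -> fW [set w | f w == 0] = box U ->
  exists lam : 'I_m -> R, (forall j, j \notin U -> 0 < lam j) /\
    forall w, f w = \sum_(j | j \notin U) lam j * slack j w.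
Proof.
move=> af f0 U0 eU; have fZ := affine_face af f0.
pose g w := \sum_(j | j \notin U) slack j w.
have subE j : ([set w | f w == 0] \subset facet j) = (j \notin U).
  rewrite fW_sub ?fW_facet ?eU //; last exact: facet_face.
  rewrite (box_sub (blk := @ps_blk n)) //; last 2 first.
  - exact: ps_blk_elt.
  - exact: ps_elt_surj.
  by rewrite subsetC sub1set inE.
have [|||eps [eps0 epsf]] := @small_multiple R _ f g.
- exact: f0.
- by move=> w; apply: sumr_ge0.
- move=> w fw; apply: big1 => j jU; move: jU; rewrite -subE => /subsetP/(_ w).
  by rewrite !inE fw eqxx => /(_ isT)/eqP.
have [||mu [mu0 muE]] := @slack_affine (fun w => f w - eps * g w).
- have [c [b fE]] := af.
  exists (c - eps *: \sum_(j | j \notin U) cf j), (b - eps * \sum_(j | j \notin U) bf j) => w.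
  rewrite fE /g /slack sumrB dotvDr -scaleNr dotvZr.
  have -> : dotv W`_w (\sum_(j | j \notin U) cf j) = \sum_(j | j \notin U) dotv W`_w (cf j).
    exact: (big_morph _ (@dotvDr _ _ _) (@dotv0r _ _ _)).
  by ring.
- by move=> w; rewrite subr_ge0.
(* At a point of the zero face off facet [j], [f - eps * g] is nonpositive and also a sum of
   nonnegative terms, so the term of [j] is 0 although its slack is not. *)
have muU j : j \in U -> mu j = 0.
  move=> jU; have : ~~ ([set w | f w == 0] \subset facet j) by rewrite subE negbK.
  case/subsetPn => w; rewrite !inE => /eqP fw sw.
  have /= := muE w; rewrite fw sub0r => muw.
  have h : \sum_j mu j * slack j w = 0.
    apply/eqP; rewrite eq_le -{1}muw oppr_le0 mulr_ge0 ?(ltW eps0) //=; last exact: sumr_ge0.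
    by apply: sumr_ge0 => l _; apply: mulr_ge0.
  have /eqP := h; rewrite psumr_eq0 => [/allP/(_ j)|l _]; last exact: mulr_ge0.
  by rewrite mem_index_enum mulf_eq0 (negbTE sw) orbF => /(_ isT)/eqP.
exists (fun j => mu j + eps); split=> [j _|w]; first by rewrite ltr_wpDl.
have /= fE := muE w; rewrite -[LHS](subrK (eps * g w)) fE.
rewrite (bigID (mem U)) /= big1 ?add0r => [|j /muU->]; last by rewrite mul0r.
rewrite mulr_sumr -big_split /=; apply: eq_bigr => j _.
by rewrite mulrDl.
Qed.

Definition slack_mx : 'M_(size W, m) := \matrix_(w, j) slack j w.
(** Its left kernel is the space of affine dependencies of the projected points. *)
Definition fibre_mx : 'M_(size W, 1 + d) :=
  row_mx (const_mx 1) (\matrix_w (W`_w *m pi)).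
Definition gale_mx := kermx fibre_mx *m slack_mx.

(** The function [b - dotv (W_w *m pi) c] is affine in the projected point: as a column it is
    [fibre_mx] times the coefficients, so every affine dependency annihilates it. *)
Lemma gale_relation (U : {set 'I_m}) (lam : 'I_m -> R) b c (x : 'rV_m) :
    (x <= gale_mx)%MS ->
    (forall w : 'I_(size W),
       b - dotv (W`_w *m pi) c = \sum_(j | j \notin U) lam j * slack j w) ->
  \sum_(j | j \notin U) lam j * x 0 j = 0.
Proof.
case/submxP => y ->; rewrite mulmxA; set a := y *m kermx _ => h.
have a0 : a *m (fibre_mx *m col_mx b%:M (- c^T)) = 0.
  by rewrite mulmxA -[a *m _]mulmxA mulmx_ker mulmx0 mul0mx.
transitivity ((a *m (fibre_mx *m col_mx b%:M (- c^T))) 0 0); last by rewrite a0 mxE.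
rewrite [RHS]mxE mul_row_col.
under eq_bigr => j _ do rewrite mxE mulr_sumr.
rewrite exchange_big; apply: eq_bigr => w _ /=.
have -> : (const_mx 1 *m b%:M + \matrix_i (W`_i *m pi) *m - c^T) w 0
    = b - dotv (W`_w *m pi) c.
  rewrite mxE mul_mx_scalar scalemx_const mulr1 mxE; congr (_ + _).
  rewrite mulmxN mxE dotvE; congr (- _).
  by rewrite !mxE; apply: eq_bigr => l _; rewrite [(\matrix_i _) _ _]mxE.
rewrite h mulr_sumr; apply: eq_bigr => j _.
by rewrite mulrCA [slack_mx _ _]mxE.
Qed.

(** Any point of the face of [W] matching [p] will do. On a facet whose box misses [p], it would
    span with that face a nonempty intersection that [fW] sends below both [[set p]] and this
    box. *)
Lemma vertex_slack (p : 'I_(size Delta)) :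
  exists w, forall j, (slack j w == 0) = (ps_elt p (ps_blk j) != j).
Proof.
have [J [fJ eJ]] : exists J, is_face W J /\ fW J = [set p].
  apply: fW_surj; apply/ps_faceP => //; exists (coords (@ps_elt R n) p).
  by rewrite (box1 (blk := @ps_blk n)) //; [exact: ps_blk_elt | exact: ps_elt_inj].
have /set0Pn[w wJ] : J != set0.
  by apply/eqP => J0; have := set11 p; rewrite -eJ J0 fW0 inE.
exists w => j.
have pbox : (p \in box [set~ j]) = (ps_elt p (ps_blk j) != j).
  apply/boxP/idP => [/(_ (ps_blk j))|h i]; rewrite !inE //.
  by apply: contraNneq h => eij; rewrite -{1}eij ps_blk_elt eij.
rewrite -pbox; apply/idP/idP => [sw|pj]; last first.
  have : J \subset facet j by rewrite fW_sub ?eJ ?fW_facet ?sub1set //; exact: facet_face.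
  by move/subsetP/(_ w wJ); rewrite inE.
apply: contraT => np.
have fJj := is_faceI fJ (facet_face j).
have : J :&: facet j = set0.
  apply: fW_inj0 => //; apply/eqP; rewrite -subset0; apply/subsetP => q hq.
  have hp : q \in [set p] by rewrite -eJ; apply: subsetP hq; rewrite -fW_sub ?subsetIl.
  have hb : q \in box [set~ j].
    by rewrite -fW_facet; apply: subsetP hq; rewrite -fW_sub ?subsetIr //; exact: facet_face.
  by move: hp hb np; rewrite inE => /eqP-> ->.
by move/setP/(_ w); rewrite !inE wJ sw.
Qed.

(** The rank is at least [m - r + 1], with [r = size n], by a triangular system. Among the columns
    in [Q], evaluation at [p0] isolates [j0]; evaluation at the neighbour of [p0] through [j] then
    isolates [j]. *)
Lemma rank_slack_mx : (m + 1 <= \rank slack_mx + size n)%N.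
Proof.
have [p0] : exists p0 : 'I_(size Delta), true.
  have /choice[f hf] : forall i, exists j, @ps_blk n j = i.
    move=> i; have : (0 < #|block (@ps_blk n) i|)%N by rewrite ps_card_block.
    by rewrite card_gt0 => /set0Pn[j]; rewrite inE => /eqP; exists j.
  by have [p _] := ps_elt_surj R hf; exists p.
move=> _; pose j0 := ps_elt p0 (Ordinal n0); pose C := coords (@ps_elt R n) p0.
have Cm := mem_coords (@ps_blk_elt R n).
have j0C : j0 \in C by rewrite Cm ps_blk_elt.
pose Q := j0 |: ~: C.
have cQ : (#|Q| + size n = m + 1)%N.
  rewrite cardsU1 inE negbK j0C -addnA addnC; congr (_ + _)%N.
  have <- : #|C| = size n by apply: (card_coords (@ps_blk_elt R n)).
  by rewrite addnC cardsC card_ord.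
rewrite -cQ leq_add2r -mxrank_tr.
have /choice[w hw] := vertex_slack.
have /choice[mv hmv] : forall j, exists q, move_to_spec (@ps_blk n) (@ps_elt R n) p0 j q.
  by move=> j; apply: move_to; [exact: ps_blk_elt | exact: ps_elt_surj].
pose A := rowsub (enum_val : 'I_#|Q| -> 'I_m) slack_mx^T.
apply: leq_trans (mxrankS (rowsub_sub (enum_val : 'I_#|Q| -> 'I_m) _)).
suff /eqP -> : row_free A by [].
apply: inj_row_free => v vA.
have vE u : \sum_l v 0 l * slack (enum_val l) u = 0.
  move/rowP/(_ u): vA; rewrite [RHS]mxE mxE => h.
  by rewrite -[RHS]h; apply: eq_bigr => l _; rewrite !mxE.
have inQ (l : 'I_#|Q|) : enum_val l \in C -> enum_val l = j0 :> 'I_m.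
  move=> lC; have : enum_val l \in Q by exact: enum_valP.
  by rewrite /Q in_setU1 in_setC lC orbF => /eqP.
have v0 l : enum_val l = j0 -> v 0 l = 0.
  move=> lj; have := vE (w p0); rewrite (bigD1 l) //= big1 => [|l' ll'].
    rewrite addr0 => /eqP; rewrite mulf_eq0 hw lj ps_blk_elt eqxx orbF.
    by move/eqP.
  apply/eqP; rewrite mulf_eq0 hw orbC -Cm; case: (boolP (_ \in C)) => //= /inQ e'.
  by case/eqP: ll'; apply: enum_val_inj; rewrite e' lj.
apply/rowP => l; rewrite mxE.
have := vE (w (mv (enum_val l))); rewrite (bigD1 l) //= big1 => [|l' ll'].
  rewrite addr0 => /eqP; rewrite mulf_eq0 hw hmv !eqxx orbF.
  by move/eqP.
apply/eqP; rewrite mulf_eq0 hw hmv; case: ifP => _.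
  by rewrite (inj_eq enum_val_inj) [l == l']eq_sym ll' orbT.
by rewrite -Cm; case: (boolP (_ \in C)) => [/inQ/v0->|_]; rewrite ?eqxx ?orbT.
Qed.

Lemma rank_gale_mx : (m + 1 <= \rank gale_mx + \rank fibre_mx + size n)%N.
Proof.
have := mxrank_mul_min (kermx fibre_mx) slack_mx; rewrite mxrank_ker -/gale_mx.
have := rank_slack_mx; have := rank_leq_row fibre_mx; lia.
Qed.

End Gale.

(** * The dimension bound *)

Lemma rank_fibre_mx (R : rcfType) (d e : nat) (V : seq 'rV[R]_d) (W : seq 'rV[R]_e)
    (pi : 'M[R]_(e, d)) :
  (forall w : 'I_(size W), in_conv V (W`_w *m pi)) ->
  (\rank (fibre_mx W pi))%:Z <= 1 + pdim V.
Proof.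
move=> convW; rewrite /pdim /fdim; case: pickP => [i0 _|no]; last first.
  have -> : \rank (fibre_mx W pi) = 0%N.
    apply/eqP; rewrite mxrank_eq0; apply/eqP/row_matrixP => w.
    have [mu [_ /eqP]] := convW w.
    by rewrite big1 ?(eq_sym 0) ?oner_eq0 // => i; have := no i; rewrite inE.
  by [].
set D := \matrix_(_ < _) _.
have sub : (fibre_mx W pi <= col_mx (row_mx 1%:M V`_i0) (row_mx (0 : 'M_(size V, 1)) D))%MS.
  apply/row_subP => w; rewrite row_row_mx rowK.
  have [mu [_ mu1 ->]] := convW w.
  rewrite -addsmxE.
  have -> : row_mx (row w (const_mx 1)) (\sum_i mu i *: V`_i) =
      row_mx 1%:M V`_i0 + \sum_i mu i *: row i (row_mx (0 : 'M_(size V, 1)) D).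
    have -> : \sum_i mu i *: V`_i = V`_i0 + \sum_i mu i *: row i D.
      rewrite -[X in X + _]scale1r -mu1 scaler_suml -big_split /=.
      by apply: eq_bigr => i _; rewrite rowK inE -scalerDr addrC subrK.
    under [in RHS]eq_bigr => i _ do rewrite row_row_mx row0 scale_row_mx scaler0.
    rewrite (_ : \sum_i row_mx 0 (mu i *: row i D) = row_mx 0 (\sum_i mu i *: row i D)).
      rewrite add_row_mx addr0; congr row_mx; apply/rowP => j.
      by rewrite !mxE ord1.
    elim/big_rec2: _ => [|i x y _ ->]; first by rewrite row_mx0.
    by rewrite add_row_mx addr0.
  apply: addmx_sub; first exact: addsmxSl.
  apply: summx_sub => i _; apply: scalemx_sub.
  exact: submx_trans (row_sub _ _) (addsmxSr _ _).
rewrite -PoszD lez_nat; apply: leq_trans (mxrankS sub) _.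
rewrite -addsmxE; apply: leq_trans (mxrank_adds_leqif _ _) _; apply: leq_add.
  exact: rank_leq_row.
rewrite (_ : row_mx 0 D = D *m row_mx 0 1%:M) ?mxrankM_maxl //.
by rewrite mul_mx_row mulmx0 mulmx1.
Qed.

Lemma ps_dim_sum (n : seq nat) : ps_dim n = (\sum_(i < size n) nth 0%N n i + size n)%N.
Proof.
rewrite /ps_dim sumnE big_map (big_nth 0%N) big_mkord.
under eq_bigr => i _ do rewrite -addn1.
by rewrite big_split /= sum1_card card_ord.
Qed.

(** [colour_bound] bounds the rank of the Gale dual plus one from above. From below, [rank_gale_mx]
    and [rank_fibre_mx] give [m + 1 - r - pdim V] with [r = size n], and [m - r] is the sum of the
    [n_i]. *)
Lemma dim_bound (R : rcfType) (k : nat) (n : seq nat) (d : nat) (V : seq 'rV[R]_d)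
    (B : {set 'I_(size n)}) (kk : 'I_(size n) -> nat) (kB : nat) :
  (0 < size n)%N -> (forall i : 'I_(size n), (0 < nth 0%N n i)%N) -> PPSN k n V ->
  (B = set0 -> kB = 0%N) -> (\sum_(i in ~: B) kk i + kB <= k)%N ->
  (\sum_(i in ~: B) kk i + kB < \sum_(i < size n) nth 0%N n i)%N ->
  ((\sum_(i < size n) nth 0%N n i)%N + 1)%:Z <=
    (\sum_(i in ~: B) (nth 0%N n i - (2 * kk i + 2))
      + (\sum_(i in B) nth 0%N n i - (2 * kB + 1)) + #|~: B| + (B != set0))%N%:Z + pdim V.
Proof.
move=> n0 npos [[fV [fV1 fV2 fV3]] [e [W [pi [[fW [fW1 fW2 fW3]] convVW]]]]] kB0 le_k lt_n.
have fW_face I : is_face W I -> is_face (prod_simplex R n) (fW I) by move=> h; case: (fW1 I h isT).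
have fW_surj J : is_face (prod_simplex R n) J -> exists I, is_face W I /\ fW I = J.
  by move=> h; have [I [h1 _ h2]] := fW2 J h isT; exists I.
have fW_sub I I' : is_face W I -> is_face W I' -> (I \subset I') = (fW I \subset fW I').
  by move=> h h'; exact: fW3.
have /choice[cb hcb] : forall j : 'I_(ps_dim n), exists cb : 'rV[R]_e * R,
    (forall w : 'I_(size W), dotv W`_w cb.1 <= cb.2) /\
    fW [set w : 'I_(size W) | cb.2 - dotv W`_w cb.1 == 0] = box (@ps_elt R n) [set~ j].
  move=> j; have [|J [[c [b [h1 h2]]] h3]] := fW_surj (box (@ps_elt R n) [set~ j]).
    by apply/ps_faceP => //; exists [set~ j].
  exists (c, b); split=> //; rewrite -h3; congr fW.
  by apply/setP => w; rewrite inE subr_eq0 eq_sym h2.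
pose cf j := (cb j).1; pose bf j := (cb j).2.
have slack0 j (w : 'I_(size W)) : 0 <= slack cf bf j w.
  by rewrite subr_ge0; case: (hcb j) => h _; apply: h.
have fW_facet j : fW (facet W cf bf j) = box (@ps_elt R n) [set~ j] by case: (hcb j).
have card_block i : #|block (@ps_blk n) i| = (nth 0%N n i).+1 by exact: ps_card_block.
have bal (U : {set 'I_(ps_dim n)}) :
    (forall i, exists2 j, j \in U & ps_blk j = i) -> (#|U| <= k + size n)%N ->
    exists lam : 'I_(ps_dim n) -> R, (forall j, j \notin U -> 0 < lam j) /\
    forall x : 'rV[R]_(ps_dim n), (x <= gale_mx W pi cf bf)%MS ->
      \sum_(j | j \notin U) lam j * x 0 j = 0.
  move=> tU cU.
  have U0 : box (@ps_elt R n) U != set0.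
    by apply/(box_transversal (@ps_blk_elt R n) (@ps_elt_surj R n)).
  have [c [b [hv hU]]] := preserved_face n0 fV2 fV3 fW_face fW_surj fW_sub convVW U0 cU.
  pose f (w : 'I_(size W)) := b - dotv (W`_w *m pi) c.
  have af : affine_on f by exists (c *m pi^T), b => w; rewrite /f dotv_mulmx.
  have f0 w : 0 <= f w.
    by rewrite subr_ge0; apply: (valid_proj convVW hv).
  have [|lam [lam0 lamE]] := slack_positive n0 fW_face fW_surj fW_sub slack0 fW_facet af f0 U0.
    rewrite -hU; congr fW; apply/setP => w.
    by rewrite !inE subr_eq0 eq_sym.
  exists lam; split=> // x xM; exact: gale_relation xM lamE.
have := colour_bound card_block npos bal kB0 le_k lt_n.
have := rank_gale_mx pi n0 fW_surj fW_sub slack0 fW_facet.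
have := rank_fibre_mx (proj_in_conv convVW).
move: (pdim V) (\rank (gale_mx _ _ _ _)) (\rank (fibre_mx _ _)) => D x y.
rewrite ps_dim_sum.
move: (\sum_(_ < _) _)%N (\sum_(_ in ~: B) _)%N (\sum_(_ in B) _ - _)%N => a b c.
move: #|~: B| (nat_of_bool (B != set0)) => u v.
lia.
Qed.

Lemma sub_sum (T : finType) (P : pred T) (c : T -> nat) (k : nat) :
  (k <= \sum_(i | P i) c i)%N ->
  exists f : T -> nat, (forall i, (f i <= c i)%N) /\ (\sum_(i | P i) f i = k)%N.
Proof.
elim: k => [|k IH] hk; first by exists (fun=> 0%N); rewrite big1.
have [f [fc fk]] := IH (ltnW hk).
have [i Pi fi] : exists2 i, P i & (f i < c i)%N.
  apply: contrapT => no; move: hk; rewrite ltnNge -fk => /negP; apply.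
  apply: leq_sum => i Pi; rewrite leqNgt; apply/negP => h; apply: no; by exists i.
exists (fun j => f j + (j == i))%N; split=> [j|].
  by case: eqP => [->|_]; rewrite ?addn1 ?addn0.
rewrite big_split /= fk (bigD1 i) //= eqxx big1 ?addn0 ?addn1 // => j /andP[_ /negbTE->].
by [].
Qed.

(* In (1) the budget [k] is distributed below the capacities; past [K1] the
   capacities are exhausted and parity allows one extra unit in each block
   counted by [K2], every such unit gaining one dimension instead of two. *)
Lemma split_budget (T : finType) (P : pred T) (cap ext : T -> nat) (capB extB k : nat) :
  (k <= \sum_(i | P i) cap i + capB + (\sum_(i | P i) ext i + extB))%N ->
  exists (f : T -> nat) (fB : nat), [/\ forall i, (f i <= cap i + ext i)%N,
    (fB <= capB + extB)%N, (\sum_(i | P i) f i + fB = k)%N &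
    (\sum_(i | P i) minn (f i) (cap i) + minn fB capB
       = minn k (\sum_(i | P i) cap i + capB))%N].
Proof.
move=> hk; have [k1|k1] := leqP k (\sum_(i | P i) cap i + capB)%N.
  have [|f [fc fk]] := @sub_sum _ P cap (minn k (\sum_(i | P i) cap i)); first exact: geq_minr.
  exists f, (k - minn k (\sum_(i | P i) cap i))%N.
  have -> : (\sum_(i | P i) minn (f i) (cap i) = \sum_(i | P i) f i)%N.
    by apply: eq_bigr => i _; apply/minn_idPl.
  rewrite fk; split=> [i|||]; first exact: leq_trans (fc i) (leq_addr _ _).
  - move: k1; move: (\sum_(i | P i) cap i)%N => a; lia.
  - move: k1; move: (\sum_(i | P i) cap i)%N => a; lia.
  - move: k1; move: (\sum_(i | P i) cap i)%N => a; lia.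
pose t := (k - (\sum_(i | P i) cap i + capB))%N.
have [|f [fc fk]] := @sub_sum _ P ext (minn t (\sum_(i | P i) ext i)); first exact: geq_minr.
exists (fun i => cap i + f i)%N, (capB + (t - minn t (\sum_(i | P i) ext i)))%N.
have -> : (\sum_(i | P i) minn (cap i + f i) (cap i) = \sum_(i | P i) cap i)%N.
  by apply: eq_bigr => i _; apply/minn_idPr/leq_addr.
rewrite big_split /= fk; split=> [i|||]; first by rewrite leq_add2l.
- move: hk k1 @t fk; move: (\sum_(i | P i) cap i)%N (\sum_(i | P i) ext i)%N => a b; lia.
- move: hk k1 @t fk; move: (\sum_(i | P i) cap i)%N (\sum_(i | P i) ext i)%N => a b; lia.
- move: hk k1 @t fk; move: (\sum_(i | P i) cap i)%N (\sum_(i | P i) ext i)%N => a b; lia.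
Qed.

(** The three cases of the theorem are one bound: [k'] is the budget actually spent, [k] in the
    first two cases and [K1 + K2] in the last. *)
Lemma pdim_bound (R : rcfType) (k k' : nat) (n : seq nat) (d : nat) (V : seq 'rV[R]_d)
    (B : {set 'I_(size n)}) :
  (0 < size n)%N -> (forall i : 'I_(size n), (0 < nth 0%N n i)%N) ->
  (forall i : 'I_(size n), nth 0%N n i = 1%N -> i \in B) -> PPSN k n V ->
  let nB := (\sum_(i in B) nth 0%N n i)%N in
  let K1 := (\sum_(i in ~: B) (nth 0%N n i - 2)./2 + (nB - 1)./2)%N in
  let K2 := (#|[set i in ~: B | odd (nth 0%N n i)]| + ((nB != 0%N) && ~~ odd nB))%N in
  (k' <= k)%N -> (k' <= K1 + K2)%N ->
  (size n)%:Z + 1 - #|B|%:Z + (k' + minn k' K1)%N%:Z <= pdim V.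
Proof.
move=> n0 npos sB hV nB K1 K2 k'k k'K.
have K2E : K2 = (\sum_(i in ~: B) odd (nth 0%N n i) + ((nB != 0%N) && ~~ odd nB))%N.
  rewrite /K2; congr (_ + _)%N; rewrite -sum1_card [RHS]big_mkcond [LHS]big_mkcond.
  by apply: eq_bigr => i _; rewrite !inE; case: (_ \in B) => //=; case: (odd _).
rewrite {}K2E in k'K; have [kk [kB [hkk hkB sk mk]]] := split_budget k'K.
have nB0 : B != set0 -> (0 < nB)%N.
  by case/set0Pn => i iB; rewrite /nB (bigD1 i) //= ltn_addr.
(* Up to the capacity, [2 * kk i + 2] fits into [n_i] and the minimum is [kk i]. One unit beyond,
   [n_i] is odd, the truncated difference is 0 and [n_i = 2 + (n_i - 1) / 2 + (n_i - 3) / 2]. The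
   identity [eB] works likewise, with [nB] even. *)
have eA i : i \in ~: B -> (nth 0%N n i = (nth 0%N n i - (2 * kk i + 2)) + 2
    + kk i + minn (kk i) (nth 0%N n i - 2)./2)%N.
  rewrite inE => iB.
  have n2 : (2 <= nth 0%N n i)%N.
    rewrite ltn_neqAle npos andbT eq_sym; apply: contra iB => /eqP; exact: sB.
  move: (hkk i) n2; move: (nth 0%N n i) (kk i) => a b; lia.
have eB : (nB = (nB - (2 * kB + 1)) + (B != set0) + kB + minn kB (nB - 1)./2)%N.
  move: nB0 hkB; have [B0|_] := eqVneq B set0.
    by rewrite /nB B0 big_set0; lia.
  by move=> /(_ isT); move: (nB) => a; lia.
have kB0 : B = set0 -> kB = 0%N.
  by move=> e; move: hkB; rewrite /nB e big_set0; lia.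
have total : (\sum_(i < size n) nth 0%N n i = \sum_(i in ~: B) nth 0%N n i + nB)%N.
  rewrite (bigID (mem B)) addnC /=; congr (_ + _)%N.
  by apply: eq_bigl => i; rewrite inE.
have cAB : (#|B| + #|~: B| = size n)%N by rewrite cardsC card_ord.
have eAs : (\sum_(i in ~: B) nth 0%N n i
   = \sum_(i in ~: B) (nth 0%N n i - (2 * kk i + 2)) + 2 * #|~: B| + \sum_(i in ~: B) kk i
     + \sum_(i in ~: B) minn (kk i) (nth 0%N n i - 2)./2)%N.
  rewrite (eq_bigr _ eA) !big_split /= sum_nat_const.
  by rewrite [(#|_| * 2)%N]mulnC.
(* At least one of [~: B] and [B] is nonempty; this makes the budget strictly smaller than the sum
   of the [n_i], as [dim_bound] requires. *)
have AB0 : (0 < #|~: B| + (B != set0))%N.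
  have [B0|_] := eqVneq B set0; last by rewrite addn1.
  rewrite /= addn0; move: cAB; rewrite B0 cards0 add0n => ->.
  exact: n0.
have := dim_bound (kk := kk) n0 npos hV kB0; rewrite sk -/nB => /(_ k'k).
move: eAs eB mk sk total cAB AB0; rewrite -/nB.
move: (pdim V) #|B| #|~: B| (nat_of_bool (B != set0)) => D b a be.
move: (\sum_(i in ~: B) _)%N (\sum_(i in ~: B) _)%N (\sum_(i in ~: B) _)%N
  (\sum_(i in ~: B) _)%N => x1 x2 x3 x4.
lia.
Qed.

(* "delta_pr(k,n) >= m" is stated as: every (k,n)-PPSN polytope has dimension >= m. *)
Theorem theorem4p9 (k : nat) (n : seq nat) (B : {set 'I_(size n)}) :
  (0 < size n)%N ->
  (forall i : 'I_(size n), (0 < nth 0%N n i)%N) ->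
  (forall i : 'I_(size n), nth 0%N n i = 1%N -> i \in B) ->
  let r := size n in
  let A := ~: B in
  let nB := (\sum_(i in B) nth 0%N n i)%N in
  let K1 := (\sum_(i in A) (nth 0%N n i - 2)./2 + (nB - 1)./2)%N in
  let K2 := (#|[set i in A | odd (nth 0%N n i)]|
             + ((nB != 0%N) && ~~ odd nB))%N in
  let base : int := r%:Z + 1 - #|B|%:Z in
  forall (R : rcfType) (d : nat) (V : seq 'rV[R]_d),
    PPSN k n V ->
    [/\ (k <= K1)%N -> base + 2 * k%:Z <= pdim V,
        (K1 <= k <= K1 + K2)%N -> base + K1%:Z + k%:Z <= pdim V &
        (K1 + K2 <= k)%N -> base + 2 * K1%:Z + K2%:Z <= pdim V].
Proof.
move=> n0 npos sB r A nB K1 K2 base R d V hV.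
have key k' : (k' <= k)%N -> (k' <= K1 + K2)%N -> base + (k' + minn k' K1)%N%:Z <= pdim V.
  exact: (pdim_bound n0 npos sB hV).
split=> [kK|/andP[Kk kK]|Kk].
- have := key k (leqnn _) (leq_trans kK (leq_addr _ _)).
  by move: (pdim V) (base) => D b; lia.
- have := key k (leqnn _) kK; move: (pdim V) (base) => D b; lia.
- have := key (K1 + K2)%N Kk (leqnn _); move: (pdim V) (base) => D b; lia.
Qed.
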